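(* Consider a $C^0$ tensor product spectral element discretization (Gauss-Lobatto Lagrange elements of degree $p\ge 1$ in each direction, as described in the context) of a domain $\Omega\subset\mathbb{R}^d$. Suppose that every element map $F_e\colon[-1,1]^d\to\Omega_e$ is affine and that the density $\rho>0$ is constant on each element. Let $K$ be the stiffness matrix, $M$ the consistent mass matrix and $\widehat{M}$ the lumped mass matrix given by the nodal quadrature method. Then $\widehat{M}\succeq M$ and $$\lambda_k(K,\widehat{M})\le\lambda_k(K,M),\qquad k=1,\dots,n,$$ where $n$ is the size of the matrices.
   Context: For symmetric matrices, $A\succeq B$ means that $A-B$ is positive semidefinite. For a symmetric positive semidefinite $A\in\mathbb{R}^{n\times n}$ and a symmetric positive definite $B\in\mathbb{R}^{n\times n}$, $\lambda_1(A,B)\le\dots\le\lambda_n(A,B)$ denote the eigenvalues of the generalized eigenproblem $A\bm{x}=\lambda B\bm{x}$ in nondecreasing order, counted with multiplicity. Setting: $\Omega\subset\mathbb{R}^d$ is an open connected domain with Lipschitz boundary, partitioned by a conforming mesh into $N$ elements $\Omega_e=F_e([-1,1]^d)$, where $F_e$ is a bijective map with Jacobian matrix $J_e$. Let $\{\hat{\bm{x}}_k,\hat{w}_k\}_{k=1}^m$, $m=(p+1)^d$, be the nodes and (positive) weights of the tensor product Gauss-Lobatto rule on $[-1,1]^d$ built from the univariate $(p+1)$-point Gauss-Lobatto (Legendre) rule, whose nodes include $\pm1$. On the reference element, the local basis functions are the tensor product Lagrange polynomials of degree $p$ in each variable interpolating at the nodes $\hat{\bm{x}}_k$; on $\Omega_e$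 they are composed with $F_e^{-1}$, giving $\varphi^e_1,\dots,\varphi^e_m$, and they are glued together across neighboring elements by identifying coinciding nodes, giving the nodal basis $\varphi_1,\dots,\varphi_n$ of a finite-dimensional space $V_h$ of continuous functions on $\Omega$ (basis functions attached to nodes on a part of the boundary where a homogeneous Dirichlet condition is prescribed, if any, are removed). The stiffness and consistent mass matrices are $$K_{ij}=\int_\Omega\kappa\,\nabla\varphi_i\cdot\nabla\varphi_j\,d\bm{x},\qquad M_{ij}=\int_\Omega\rho\,\varphi_i\varphi_j\,d\bm{x},$$ with positive-valued coefficient functions $\kappa$ and $\rho$. Equivalently, $M$ is obtained by the usual finite element assembly of the element matrices $(M_e)_{ij}=\int_{\Omega_e}\rho\,\varphi^e_i\varphi^e_j\,d\bm{x}$. The lumped mass matrix $\widehat{M}$ is obtained by the same assembly from the element matrices $$(\widehat{M}_e)_{ij}=\sum_{k=1}^m w^e_k\,\varphi^e_i(\bm{x}^e_k)\varphi^e_j(\bm{x}^e_k)=w^e_i\delta_{ij},$$ where $\bm{x}^e_k=F_e(\hat{\bm{x}}_k)$ and $w^e_k=\hat{w}_k\,\rho(F_e(\hat{\bm{x}}_k))\,|\det J_e(\hat{\bm{x}}_k)|$ (with $\rho$ taken as its value on the element $\Omega_e$). *)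

(* Defs.v *)
From HB Require Import structures.
From mathcomp Require Import all_boot all_order all_algebra.
From mathcomp Require Import all_classical all_reals all_analysis.
From mathcomp Require Import measurable_realfun.

Set Implicit Arguments.
Unset Strict Implicit.
Unset Printing Implicit Defensive.

Import Order.TTheory GRing.Theory Num.Theory.
Import numFieldNormedType.Exports.

Local Open Scope classical_set_scope.
Local Open Scope ring_scope.

(* R^d is 'rV[R]_d, equipped with its Borel sigma-algebra. *)
Definition borel_rV (R : realType) (d : nat) : measurableType _ :=
  g_sigma_algebraType (@open 'rV[R]_d).

Lemma measurable_coord (R : realType) (d : nat) (i : 'I_d) :
  measurable_fun [set: borel_rV R d] (fun x : borel_rV R d => (x : 'rV[R]_d) 0 i).
Proof.
apply: (@measurability _ _ (borel_rV R d) (measurableTypeR R) setT _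
  (@RGenOpens.G R)).
  exact: RGenOpens.measurableE.
move=> _ [_ [a [b ->]] <-].
rewrite setTI; apply: sub_sigma_algebra.
apply: (@open_comp _ _ (fun x : 'rV[R]_d => x 0 i)); last exact: interval_open.
by move=> x _; exact: coord_continuous.
Qed.

Lemma measurable_fun_borel_rV (R : realType) (d : nat) d1
    (T : measurableType d1) (f : T -> borel_rV R d) :
  (forall i, measurable_fun [set: T] (fun t => (f t : 'rV[R]_d) 0 i)) ->
  measurable_fun [set: T] f.
Proof.
move=> mf.
apply: (@measurability _ _ _ (borel_rV R d) _ _ (@open 'rV[R]_d)) => //.
move=> _ [U oU <-]; rewrite setTI.
pose c (q : 'rV[rat]_d) : 'rV[R]_d := map_mx ratr q.
pose I := [set qn : 'rV[rat]_d * nat | ball (c qn.1) (qn.2.+1%:R^-1) `<=` U].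
have -> : U = \bigcup_(qn in I) (ball (c qn.1) (qn.2.+1%:R^-1) : set 'rV[R]_d).
  apply/seteqP; split => [x Ux|x [qn Iqn]]; last exact: Iqn.
  have [e /= e0 xeU] := (nbhs_ballP _ _).1 (open_nbhs_nbhs (conj oU Ux)).
  pose n := Num.truncn (2 / e).
  have ne : n.+1%:R^-1 < e / 2.
    rewrite -[e / 2]invrK ltf_pV2 ?posrE ?invr_gt0 ?divr_gt0 ?ltr0n//.
    by rewrite invf_div truncnS_gt.
  have n0 : 0 < n.+1%:R^-1 :> R by rewrite invr_gt0 ltr0n.
  have Hq i : exists q : rat, `|x 0 i - ratr q| < n.+1%:R^-1.
    have /rat_in_itvoo[q] : x 0 i - n.+1%:R^-1 < x 0 i + n.+1%:R^-1.
      by rewrite ltrD2l gtrN.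
    by rewrite in_itv/= -ltr_distl distrC; exists q.
  pose q : 'rV[rat]_d := \row_i sval (cid (Hq i)).
  exists (q, n) => /=.
    move=> y qy; apply: xeU.
    have [_ {}qy] := qy.
    split => // i j; rewrite (ord1 i) /ball/=.
    have := qy 0 j; rewrite !mxE /ball/= => h.
    have h1 := svalP (cid (Hq j)).
    rewrite (le_lt_trans (ler_distD (ratr (sval (cid (Hq j)))) _ _))//.
    by rewrite (splitr e) ltrD// (lt_trans _ ne).
  split => // i j; rewrite (ord1 i) !mxE /ball/= distrC.
  exact: svalP (cid (Hq j)).
rewrite preimage_bigcup bigcup_mkcond.
apply: countable_bigcupT_measurable => [|qn]; first exact: countableP.
case: ifP => // _.
have -> : f @^-1` (ball (c qn.1) qn.2.+1%:R^-1 : set 'rV[R]_d) =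
    \big[setI/setT]_(i < d)
      (fun t => (f t : 'rV[R]_d) 0 i) @^-1` ball (c qn.1 0 i) qn.2.+1%:R^-1.
  rewrite -bigcap_seq; apply/seteqP; split => [t [_ +] i _|t ft]; first exact.
  split => [|j i]; first by rewrite invr_gt0 ltr0n.
  by rewrite (ord1 j); apply: ft; rewrite /= mem_index_enum.
apply: bigsetI_measurable => i _; rewrite -[X in measurable X]setTI.
by apply: mf => //; apply: open_measurable; exact: ball_open.
Qed.

Section lebesgue_step.
Context (R : realType) (d : nat).
Variable mu : {sigma_finite_measure set (borel_rV R d) -> \bar R}.

Definition cons_rV (z : measurableTypeR R * borel_rV R d) : borel_rV R d.+1 :=
  row_mx (z.1%:M : 'rV[R]_1) (z.2 : 'rV[R]_d).

Lemma measurable_cons_rV : measurable_fun setT cons_rV.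
Proof.
apply: measurable_fun_borel_rV => i; rewrite /cons_rV.
have [j ->|j ->] := @split_ordP 1 d i.
  apply: (eq_measurable_fun (fun z : measurableTypeR R * borel_rV R d => z.1)).
    move=> z _; apply/esym.
    apply: (etrans (row_mxEl (z.1%:M : 'rV[R]_1) (z.2 : 'rV[R]_d) 0 j)).
    by rewrite (ord1 j) mxE eqxx.
  exact: measurable_fst.
apply: (eq_measurable_fun
    (fun z : measurableTypeR R * borel_rV R d => (z.2 : 'rV[R]_d) 0 j)).
  move=> z _; apply/esym.
  exact: (row_mxEr (z.1%:M : 'rV[R]_1) (z.2 : 'rV[R]_d) 0 j).
apply: (measurableT_comp (measurable_coord j)).
exact: measurable_snd.
Qed.

Definition lebesgue_cons : set (borel_rV R d.+1) -> \bar R :=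
  pushforward (lebesgue_measure \x mu)%E cons_rV.

Let lebesgue_cons0 : lebesgue_cons set0 = 0%E.
Proof. by rewrite /lebesgue_cons /pushforward preimage_set0 measure0. Qed.

Let lebesgue_cons_ge0 A : (0 <= lebesgue_cons A)%E.
Proof. by rewrite /lebesgue_cons /pushforward; exact: measure_ge0. Qed.

Let lebesgue_cons_sigma_additive : semi_sigma_additive lebesgue_cons.
Proof.
move=> F mF tF mUF; rewrite /lebesgue_cons /pushforward preimage_bigcup.
apply: measure_semi_sigma_additive.
- by move=> n; rewrite -[X in measurable X]setTI; exact: measurable_cons_rV.
- apply/trivIsetP => /= i j _ _ ij; rewrite -preimage_setI.
  by move/trivIsetP : tF => /(_ _ _ _ _ ij) ->//; rewrite preimage_set0.
- by rewrite -preimage_bigcup -[X in measurable X]setTI; exact: measurable_cons_rV.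
Qed.

HB.instance Definition _ := isMeasure.Build _ _ _ lebesgue_cons
  lebesgue_cons0 lebesgue_cons_ge0 lebesgue_cons_sigma_additive.

Let lebesgue_cons_sigma_finite : sigma_finite setT lebesgue_cons.
Proof.
pose leb : {sigma_finite_measure set (measurableTypeR R) -> \bar R} :=
  lebesgue_measure.
have /sigma_finiteP[A [AT ndA Aoo]] := sigma_finiteT leb.
have /sigma_finiteP[B [BT ndB Boo]] := sigma_finiteT mu.
pose u (x : borel_rV R d.+1) : measurableTypeR R * borel_rV R d :=
  ((x : 'rV[R]_(1 + d)) 0 (@lshift 1 d 0), rsubmx (x : 'rV[R]_(1 + d))).
have mu_ : measurable_fun setT u.
  apply/measurable_fun_pairP; split.
    rewrite (_ : _ \o u =
      fun x : borel_rV R d.+1 => (x : 'rV[R]_(1 + d)) 0 (@lshift 1 d 0))//.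
    exact: (@measurable_coord R d.+1 (@lshift 1 d 0)).
  apply: measurable_fun_borel_rV => i.
  apply: (eq_measurable_fun
    (fun x : borel_rV R d.+1 => (x : 'rV[R]_(1 + d)) 0 (rshift 1 i))).
    by move=> x _; rewrite /u /= mxE.
  exact: (@measurable_coord R d.+1 (@rshift 1 d i)).
have uK z : u (cons_rV z) = z.
  case: z => a b; rewrite /u /cons_rV /=; congr pair.
    by rewrite row_mxEl mxE eqxx.
  by rewrite row_mxKr.
exists (fun n => u @^-1` (A n `*` B n)).
  rewrite -preimage_bigcup; apply/seteqP; split => // x _.
  have [k _ Ak] : (\bigcup_n A n) (u x).1 by rewrite -AT.
  have [l _ Bl] : (\bigcup_n B n) (u x).2 by rewrite -BT.
  exists (maxn k l) => //; split.
    by move: (u x).1 Ak; exact/subsetPset/ndA/leq_maxl.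
  by move: (u x).2 Bl; exact/subsetPset/ndB/leq_maxr.
move=> k; have [mA Afin] := Aoo k; have [mB Bfin] := Boo k; split.
  by rewrite -[X in measurable X]setTI; apply: mu_ => //; exact: measurableX.
rewrite /lebesgue_cons /pushforward -comp_preimage.
rewrite (_ : u \o cons_rV = id); last by apply/funext => z; exact: uK.
rewrite preimage_id product_measure1E//.
by rewrite lte_mul_pinfty// ge0_fin_numE.
Qed.

HB.instance Definition _ := Measure_isSigmaFinite.Build _ _ _ lebesgue_cons
  lebesgue_cons_sigma_finite.

End lebesgue_step.

(* d-dimensional Lebesgue measure: the d-fold product of the one-dimensional one,
   transported to row vectors. *)
Fixpoint lebesgue_rV (R : realType) (d : nat) :
    {sigma_finite_measure set (borel_rV R d) -> \bar R} :=
  if d is d'.+1 then lebesgue_cons (lebesgue_rV R d')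
  else dirac ((0 : 'rV[R]_0) : borel_rV R 0).


Definition psdmx (R : realType) (n : nat) (A : 'M[R]_n) : Prop :=
  A^T = A /\ forall v : 'cV[R]_n, 0 <= (v^T *m A *m v) 0 0.

Definition loewner_ge (R : realType) (n : nat) (A B : 'M[R]_n) : Prop :=
  psdmx (A - B).

(* The multiplicity of t is the dimension of {v | A v = t B v}; kermx is a row
   kernel, hence the transpose. *)
Definition gen_spectrum (R : realType) (n : nat) (A B : 'M[R]_n) : set (seq R) :=
  [set s | sorted <=%R s /\ size s = n /\
    forall t : R, count_mem t s = \rank (kermx (A - t *: B)^T)].

(* [gen_eigenvalue A B k] is lambda_(k+1)(A, B), indices of 'I_n being 0-based.
   The spectrum is unique when it exists, in particular for A symmetric and B
   symmetric positive definite. *)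
Definition gen_eigenvalue (R : realType) (n : nat) (A B : 'M[R]_n) (k : 'I_n) : R :=
  nth 0 (xget [::] (gen_spectrum A B)) k.

Definition legendre (R : realType) (p : nat) : {poly R} :=
  (2 ^+ p * p`!%:R)^-1 *: (('X^2 - 1) ^+ p)^`(p).

Definition lagrange (R : realType) (p : nat) (xi : 'I_p.+1 -> R) (a : 'I_p.+1)
    (t : R) : R :=
  \prod_(b < p.+1 | b != a) ((t - xi b) / (xi a - xi b)).

(* Nodes: the endpoints and the p - 1 zeros of P_p'; the weights integrate the
   interpolant. *)
Definition gauss_lobatto (R : realType) (p : nat) (xi w : 'I_p.+1 -> R) : Prop :=
  [/\ {homo xi : a b / (a < b)%N >-> a < b},
      xi ord0 = -1,
      xi ord_max = 1,
      forall a, a != ord0 -> a != ord_max -> root (legendre R p)^`() (xi a) &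
      forall a, w a = \int[lebesgue_measure]_(t in `[-1, 1]) lagrange xi a t].

(* The m = (p+1)^d tensor nodes are indexed by multi-indices. *)
Definition multi_index (d p : nat) := {ffun 'I_d -> 'I_p.+1}.

Definition tensor_node (R : realType) (d p : nat) (xi : 'I_p.+1 -> R)
    (k : multi_index d p) : 'rV[R]_d :=
  \row_c xi (k c).

Definition tensor_weight (R : realType) (d p : nat) (w : 'I_p.+1 -> R)
    (k : multi_index d p) : R :=
  \prod_(c < d) w (k c).

Definition tensor_lagrange (R : realType) (d p : nat) (xi : 'I_p.+1 -> R)
    (k : multi_index d p) (z : 'rV[R]_d) : R :=
  \prod_(c < d) lagrange xi (k c) (z 0 c).

Definition dotv (R : realType) (d : nat) (u v : 'rV[R]_d) : R :=
  (u *m v^T) 0 0.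

(* Locally, Omega is the strict subgraph, in some unit direction nu, of a
   Lipschitz function of the component orthogonal to nu. *)
Definition lipschitz_boundary (R : realType) (d : nat) (Omega : set 'rV[R]_d) : Prop :=
  forall x, (closure Omega `\` interior Omega) x ->
  exists (U : set 'rV[R]_d) (nu : 'rV[R]_d) (g : 'rV[R]_d -> R),
    [/\ nbhs x U, dotv nu nu = 1, [lipschitz g z | z in setT] &
        forall y, U y -> (Omega y <-> dotv y nu < g (y - dotv y nu *: nu))].

Definition ref_cube (R : realType) (d : nat) : set 'rV[R]_d :=
  [set z | forall c, -1 <= z 0 c <= 1].

Definition ref_face (R : realType) (d : nat) (s : 'I_d -> option bool) :
    set 'rV[R]_d :=
  [set z | ref_cube z /\
    forall c, if s c is Some b then z 0 c = (-1) ^+ b else True].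

Definition element (R : realType) (d : nat) (F : 'rV[R]_d -> 'rV[R]_d) :
    set 'rV[R]_d :=
  F @` @ref_cube R d.

Definition conforming_mesh (R : realType) (d N : nat) (Omega : set 'rV[R]_d)
    (F : 'I_N -> 'rV[R]_d -> 'rV[R]_d) : Prop :=
  [/\ forall e, set_inj (@ref_cube R d) (F e),
      closure Omega = \bigcup_e element (F e),
      forall e e', e != e' ->
        interior (element (F e)) `&` interior (element (F e')) = set0 &
      forall e e', e != e' ->
        element (F e) `&` element (F e') = set0 \/
        exists s s', element (F e) `&` element (F e') = F e @` @ref_face R d s /\
                     element (F e) `&` element (F e') = F e' @` @ref_face R d s'].

Definition affine_map (R : realType) (d : nat) (F : 'rV[R]_d -> 'rV[R]_d) : Prop :=
  exists (A : 'M[R]_d) (b : 'rV[R]_d), forall z, F z = z *m A + b.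

Section basis.
Context (R : realType) (d p N n : nat).
Variables (F : 'I_N -> 'rV[R]_d -> 'rV[R]_d) (xi : 'I_p.+1 -> R).

Definition elt_node (e : 'I_N) (k : multi_index d p) : 'rV[R]_d :=
  F e (tensor_node xi k).

Definition elt_basis (e : 'I_N) (k : multi_index d p) (y : 'rV[R]_d) : R :=
  tensor_lagrange xi k (pinv (@ref_cube R d) (F e) y).

(* [X] lists without repetition the global nodes that are not on the Dirichlet
   part [GammaD] of the boundary. *)
Definition free_nodes (GammaD : set 'rV[R]_d) (X : 'I_n -> 'rV[R]_d) : Prop :=
  injective X /\
  range X = [set y | exists e k, y = elt_node e k] `\` GammaD.

Variable X : 'I_n -> 'rV[R]_d.

(* On a conforming mesh, with affine maps, the value does not depend on the
   element picked among those containing [y]; each element has at most one node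
   equal to [X i]. *)
Definition glob_basis (i : 'I_n) (y : 'rV[R]_d) : R :=
  if [pick e | y \in element (F e)] is Some e
  then \sum_(k | elt_node e k == X i) elt_basis e k y
  else 0.

Definition assemble (E : 'I_N -> multi_index d p -> multi_index d p -> R) : 'M[R]_n :=
  \matrix_(i, j) \sum_(e < N) \sum_(k | elt_node e k == X i)
    \sum_(l | elt_node e l == X j) E e k l.

Definition gradient (f : 'rV[R]_d -> R) (y : 'rV[R]_d) : 'rV[R]_d :=
  \row_c 'D_(delta_mx 0 c) f y.

Definition stiffness_integrand (kappa : 'rV[R]_d -> R) (i j : 'I_n)
    (y : borel_rV R d) : R :=
  kappa y * dotv (gradient (glob_basis i) y) (gradient (glob_basis j) y).

Definition stiffness (Omega : set 'rV[R]_d) (kappa : 'rV[R]_d -> R) : 'M[R]_n :=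
  \matrix_(i, j) \int[lebesgue_rV R d]_(y in (Omega : set (borel_rV R d)))
    stiffness_integrand kappa i j y.

Definition consistent_mass (Omega : set 'rV[R]_d) (rho : 'rV[R]_d -> R) : 'M[R]_n :=
  \matrix_(i, j) \int[lebesgue_rV R d]_(y in (Omega : set (borel_rV R d)))
    (rho y * glob_basis i y * glob_basis j y).

(* [r e] is the value of the density on the element [e]. *)
Definition elt_weight (w : 'I_p.+1 -> R) (r : 'I_N -> R) (e : 'I_N)
    (k : multi_index d p) : R :=
  tensor_weight w k * r e * `|\det (jacobian (F e) (tensor_node xi k))|.

Definition lumped_mass (w : 'I_p.+1 -> R) (r : 'I_N -> R) : 'M[R]_n :=
  assemble (fun e k l => \sum_q elt_weight w r e q *
    elt_basis e k (elt_node e q) * elt_basis e l (elt_node e q)).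

End basis.

(* Main.v *)
Require Import Defs.
From mathcomp Require Import all_boot all_order all_algebra.
From mathcomp Require Import all_classical all_reals all_analysis.
From mathcomp Require Import measurable_realfun.
From mathcomp Require Import complex spectral.
From mathcomp Require Import ring lra zify.

Set Implicit Arguments.
Unset Strict Implicit.
Unset Printing Implicit Defensive.

Import Order.TTheory GRing.Theory Num.Theory.
Import numFieldNormedType.Exports.

Local Open Scope classical_set_scope.
Local Open Scope ring_scope.

(** On each element both mass matrices are, up to the factor [r e * |det A_e|],
    [d]-fold tensor powers of matrices of size [p + 1]: the Gram matrix
    [lagrange_gram] of the Lagrange polynomials on [[-1, 1]] for the consistent
    mass ([consistent_massE]) and the diagonal matrix of the weights for the
    lumped one ([lumped_massE]). Three facts then give the theorem.

    In dimension one, [lagrange_gram <= diag w], that is,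
    [int q^2 <= \sum_a w_a q(xi_a)^2] for [deg q <= p] ([quadrature_sqr_ge]). The
    rule is exact up to degree [2p - 1], because the polynomial
    [(X^2 - 1) P_p'] vanishing at the nodes is orthogonal to the polynomials of
    degree at most [p - 2]. Modulo degree [2p - 1], the square [q^2] is a
    nonnegative multiple of [(X^2 - 1) P_p'^2], to which the rule gives the value
    0 while its integral is nonpositive.

    Tensor powers preserve this inequality between nonnegative forms
    ([tensor_form_le]) and preserve positive definiteness ([tensor_form_gt0]).
    Assembly is a congruence ([qform_assembled_mass]), injective because every
    global node belongs to some element; whence [Mhat >= M > 0].

    For [K >= 0] the eigenvalues of [(K, B)] decrease when [B > 0] increases
    ([gen_eigenvalue_anti]): for [t >= 0], the form [K - t B] becomes more negative,
    so that more eigenvalues lie below [t].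

    The bulk of the analysis computes [M]. The open elements are contained in
    Omega, since a Lipschitz domain contains the interior of its closure, and they
    fill it up to a null set; on each of them the integral is reduced to the
    reference cube by an affine change of variables, and there to
    one-dimensional integrals by Fubini's theorem. *)

(** * Simultaneous diagonalization of a definite pencil *)

Definition qform (R : realType) (n : nat) (A : 'M[R]_n) (v : 'rV[R]_n) : R :=
  (v *m A *m v^T) 0 0.

Definition posdefmx (R : realType) (n : nat) (A : 'M[R]_n) : Prop :=
  A^T = A /\ forall v, v != 0 -> 0 < qform A v.

Lemma qformB (R : realType) (n : nat) (A B : 'M[R]_n) v :
  qform (A - B) v = qform A v - qform B v.
Proof. by rewrite /qform mulmxBr mulmxBl !mxE. Qed.

Lemma qformZ (R : realType) (n : nat) (a : R) (A : 'M[R]_n) v :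
  qform (a *: A) v = a * qform A v.
Proof. by rewrite /qform -scalemxAr -scalemxAl !mxE. Qed.

Lemma posdef_unit (R : realType) (n : nat) (A : 'M[R]_n) :
  posdefmx A -> A \in unitmx.
Proof.
move=> [_ A0]; rewrite -row_free_unit -kermx_eq0; apply/rowV0P => v /sub_kermxP vA.
by apply/eqP; apply: contraT => /A0; rewrite /qform vA mul0mx mxE ltxx.
Qed.

Lemma map_Re_mul (R : realType) (m n p : nat) (v : 'M[R[i]]_(m, n)) (A : 'M[R]_(n, p)) :
  map_mx (@complex.Re R) (v *m map_mx (real_complex R) A) =
  map_mx (@complex.Re R) v *m A.
Proof.
apply/matrixP => i j; rewrite !mxE (raddf_sum (@complex.Re R)).
by apply: eq_bigr => k _; rewrite !mxE; case: (v i k) => a b /=; rewrite mulr0 subr0.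
Qed.

Lemma map_Im_mul (R : realType) (m n p : nat) (v : 'M[R[i]]_(m, n)) (A : 'M[R]_(n, p)) :
  map_mx (@complex.Im R) (v *m map_mx (real_complex R) A) =
  map_mx (@complex.Im R) v *m A.
Proof.
apply/matrixP => i j; rewrite !mxE (raddf_sum (@complex.Im R)).
by apply: eq_bigr => k _; rewrite !mxE; case: (v i k) => a b /=; rewrite mulr0 add0r.
Qed.

Lemma sym_form (R : realType) (n : nat) (A : 'M[R]_n) (u v : 'rV[R]_n) :
  A^T = A -> (u *m A *m v^T) 0 0 = (v *m A *m u^T) 0 0.
Proof.
move=> sA.
have -> : v *m A *m u^T = (u *m A *m v^T)^T by rewrite !trmx_mul trmxK sA mulmxA.
by rewrite [RHS]mxE.
Qed.

(** Over the complex numbers the row eigenproblem of [A B^-1] has a solution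
    [z = u + i w], of eigenvalue [x + i y]. Computing [u A w^T] in two ways by
    symmetry gives [y (u B u^T + w B w^T) = 0], hence [y = 0], and [u] or [w] is a
    real eigenvector. *)
Lemma pencil_eigenvector (R : realType) (n : nat) (A B : 'M[R]_n.+1) :
  A^T = A -> posdefmx B ->
  exists (t : R) (v : 'rV[R]_n.+1), v != 0 /\ v *m A = t *: (v *m B).
Proof.
move=> sA pB; have uB := posdef_unit pB; have [sB B0] := pB.
pose G := A *m invmx B.
have [a /eigenvalueP[z zG z0]] :=
  eigenvalue_closed (map_mx (real_complex R) G) (ltn0Sn n).
pose u := map_mx (@complex.Re R) z; pose w := map_mx (@complex.Im R) z.
pose x := complex.Re a; pose y := complex.Im a.
have E1 : u *m A = x *: (u *m B) - y *: (w *m B).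
  have := congr1 (map_mx (@complex.Re R)) zG; rewrite map_Re_mul => /(congr1 (mulmx^~ B)).
  rewrite /G mulmxA mulmxKV// => ->; rewrite !scalemxAl -mulmxBl; congr (_ *m _).
  by apply/matrixP => i j; rewrite !mxE /x /y; case: (a) (z i j) => ? ? [].
have E2 : w *m A = x *: (w *m B) + y *: (u *m B).
  have := congr1 (map_mx (@complex.Im R)) zG; rewrite map_Im_mul => /(congr1 (mulmx^~ B)).
  rewrite /G mulmxA mulmxKV// => ->; rewrite !scalemxAl -mulmxDl; congr (_ *m _).
  by apply/matrixP => i j; rewrite !mxE /x /y; case: (a) (z i j) => ? ? [].
have uw0 : (u != 0) || (w != 0).
  rewrite -negb_and; apply: contra z0 => /andP[/eqP u0 /eqP w0]; apply/eqP/matrixP => i j.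
  move/matrixP/(_ i j) : u0; move/matrixP/(_ i j) : w0; rewrite !mxE.
  by case: (z i j) => ? ? /= -> ->.
have y0 : y = 0.
  have S1 := sym_form u w sA; have S2 := sym_form u w sB.
  have : y * (qform B u + qform B w) = 0.
    move: S1 S2; rewrite E1 E2 !mulmxDl !mulNmx -!scalemxAl /qform.
    move: (u *m B *m w^T) (w *m B *m u^T) (u *m B *m u^T) (w *m B *m w^T) => a1 a2 a3 a4.
    by rewrite !mxE => S1 S2; rewrite S2 in S1; lra.
  move/eqP; rewrite mulf_eq0 => /orP[/eqP//|/eqP q0]; exfalso.
  have q (v : 'rV[R]_n.+1) : 0 <= qform B v.
    have [->|/B0/ltW//] := eqVneq v 0; by rewrite /qform !mul0mx mxE.
  case/orP: uw0 => /B0; [have := q w|have := q u]; move: q0; lra.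
move: E1 E2; rewrite y0 !scale0r subr0 addr0 => E1 E2.
by case/orP: uw0 => h; [exists x, u|exists x, w].
Qed.

(** The dimension is a variable [m], and not the rank itself, because the size of
    [S] has to be the [n] of the induction in [pencil_diag]. *)
Lemma complement_basis (R : realType) (n m : nat) (c : 'cV[R]_n) :
  \rank (kermx c) = m -> exists S : 'M[R]_(m, n), row_free S /\ S *m c = 0.
Proof.
move=> <-; exists (row_base (kermx c)); split; first exact: row_base_free.
by apply/sub_kermxP; rewrite eq_row_base.
Qed.

(** The rows of [P] are eigenvectors. By induction: one normalized eigenvector
    [v], completed by eigenvectors of the pencil restricted to the [B]-orthogonal
    complement of [v], which is stable because [v A] is proportional to [v B]. *)
Lemma pencil_diag (R : realType) (n : nat) (A B : 'M[R]_n) :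
  A^T = A -> posdefmx B ->
  exists (P : 'M[R]_n) (D : 'rV[R]_n),
    P *m B *m P^T = 1%:M /\ P *m A *m P^T = diag_mx D.
Proof.
elim: n A B => [|n IH] A B sA pB.
  by exists 0, 0; split; apply/matrixP => -[].
have [t [v0 [v0n0 v0A]]] := pencil_eigenvector sA pB.
have [sB B0] := pB.
pose b := Num.sqrt (qform B v0).
have b0 : 0 < b by rewrite sqrtr_gt0 B0.
pose v := b^-1 *: v0.
have vA : v *m A = t *: (v *m B) by rewrite -!scalemxAl v0A !scalerA mulrC.
have vB : v *m B *m v^T = 1%:M.
  apply/matrixP => i j; rewrite !ord1 /v linearZ /= -!scalemxAr -!scalemxAl.
  have : b ^+ 2 = qform B v0 by rewrite sqr_sqrtr// ltW// B0.
  rewrite /qform; move: (v0 *m B *m v0^T) => q; rewrite !mxE eqxx => <- /=; field.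
  exact: lt0r_neq0.
have vn0 : v != 0 by rewrite scaler_eq0 negb_or v0n0 invr_eq0 gt_eqF.
clearbody v.
have rk : \rank (kermx (B *m v^T)) = n.
  rewrite mxrank_ker -mxrank_tr rank_rV.
  suff -> : (B *m v^T)^T != 0 by rewrite subSS subn0.
  apply/negP => /eqP /(congr1 trmx); rewrite trmxK trmx0 => h.
  move: vB; rewrite -mulmxA h mulmx0 => /matrixP/(_ 0 0); rewrite !mxE eqxx.
  by move/esym/eqP; rewrite oner_eq0.
have [S [fS SB]] := complement_basis rk.
have [|| Q [D [QB QA]]] := IH (S *m A *m S^T) (S *m B *m S^T).
- by rewrite !trmx_mul trmxK sA mulmxA.
- split=> [|u u0]; first by rewrite !trmx_mul trmxK sB mulmxA.
  rewrite /qform !mulmxA -mulmxA -trmx_mul; apply: B0.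
  apply: contra u0 => /eqP uS; apply/eqP/(row_free_inj fS).
  by rewrite uS mul0mx.
have vBS : v *m B *m S^T = 0.
  by rewrite -[RHS]trmx0 -SB !trmx_mul trmxK sB.
pose P : 'M[R]_(1 + n, n.+1) := col_mx v (Q *m S).
suff [] : P *m B *m P^T = 1%:M /\ P *m A *m P^T = diag_mx (row_mx t%:M D).
  by exists P, (row_mx t%:M D).
rewrite /P; split.
  rewrite tr_col_mx mul_col_mx mul_col_row vB.
  rewrite trmx_mul !mulmxA vBS mul0mx -[Q *m S *m B *m v^T]mulmxA -[Q *m S *m _]mulmxA SB mulmx0.
  by rewrite scalar_mx_block; congr block_mx; rewrite -QB !mulmxA.
rewrite tr_col_mx mul_col_mx mul_col_row vA -!scalemxAl vB.
have vAT : A *m v^T = t *: (B *m v^T).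
  by rewrite -[in LHS]sA -trmx_mul vA linearZ /= trmx_mul sB.
rewrite trmx_mul !mulmxA vBS mul0mx -[Q *m S *m A *m v^T]mulmxA -[Q *m S *m _]mulmxA vAT.
rewrite -scalemxAr SB !scaler0 mulmx0 diag_mx_row.
congr block_mx; last by rewrite -QA !mulmxA.
by apply/matrixP => i j; rewrite !ord1 !mxE mulr1.
Qed.

(** * Generalized eigenvalues *)

Lemma mxrank_diag (R : realType) (n : nat) (D : 'rV[R]_n) :
  \rank (diag_mx D) = (\sum_i (D 0%R i != 0%R))%N.
Proof.
elim: n D => [|n IH] D.
  by rewrite big_ord0; apply/eqP; rewrite -leqn0 rank_leq_row.
move: D; suff H (x : 'rV[R]_1) (y : 'rV[R]_n) : \rank (diag_mx (row_mx x y)) =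
    (\sum_(i < 1 + n) (row_mx x y 0%R i != 0%R))%N.
  by move=> D; rewrite -[D](@hsubmxK _ 1 1 n); exact: H.
rewrite diag_mx_row rank_diag_block_mx IH big_ord_recl.
have -> : diag_mx x = x by apply/matrixP => i j; rewrite !ord1 !mxE eqxx.
congr (_ + _)%N.
  rewrite rank_rV; congr (nat_of_bool (~~ _)).
  have -> : row_mx x y 0 ord0 = x 0 0.
    by rewrite -(row_mxEl x y); congr (row_mx x y _ _); exact: val_inj.
  apply/eqP/eqP => [->|x0]; first by rewrite mxE.
  by apply/matrixP => i j; rewrite !ord1 x0 mxE.
apply: eq_bigr => i _; rewrite -(row_mxEr x y).
by congr (nat_of_bool (~~ (row_mx x y _ _ == _))); exact: val_inj.
Qed.

Lemma qform_mul (R : realType) (m n : nat) (A : 'M[R]_n) (P : 'M[R]_(m, n)) x :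
  qform A (x *m P) = qform (P *m A *m P^T) x.
Proof. by rewrite /qform trmx_mul !mulmxA. Qed.

Lemma qform_delta (R : realType) (n : nat) (D : 'rV[R]_n) i :
  qform (diag_mx D) (delta_mx 0 i) = D 0 i.
Proof.
rewrite /qform -rowE row_diag_mx -scalemxAl trmx_delta mul_delta_mx.
by rewrite !mxE !eqxx mulr1.
Qed.

Lemma count_sum (T : Type) (n : nat) (f : 'I_n -> T) (a : pred T) :
  count a [seq f i | i <- enum 'I_n] = (\sum_(i < n) a (f i))%N.
Proof.
rewrite count_map -sum1_count big_enum_cond big_mkcond /=.
by apply: eq_bigr => i _; case: (a (f i)).
Qed.

(** [A - t B] is congruent to [D - t], so the multiplicity of [t] is the number of
    its occurrences in [D]; two sorted lists with the same multiplicities are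
    equal, which makes the spectrum unique. *)
Lemma pencil_spectrum (R : realType) (n : nat) (A B P : 'M[R]_n) (D : 'rV[R]_n)
    (k : 'I_n) :
  P *m B *m P^T = 1%:M -> P *m A *m P^T = diag_mx D ->
  gen_eigenvalue A B k = nth 0 (sort <=%R [seq D 0 i | i <- enum 'I_n]) k.
Proof.
move=> PB PA; set s := sort _ _.
have uP : P \in unitmx.
  by move: PB; rewrite -mulmxA => /mulmx1_unit[].
have cnt t : count_mem t s = \rank (kermx (A - t *: B)^T).
  rewrite /s count_sort count_sum mxrank_ker mxrank_tr.
  have -> : \rank (A - t *: B) = \rank (diag_mx (D - const_mx t)).
    rewrite linearB /= -PA diag_const_mx -[t%:M]scalemx1 -PB.
    rewrite scalemxAl scalemxAr -mulmxBl -mulmxBr.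
    rewrite mxrankMfree ?row_free_unit ?unitmx_tr//.
    by rewrite -[RHS]mxrank_tr trmx_mul mxrankMfree ?row_free_unit ?unitmx_tr// mxrank_tr.
  rewrite mxrank_diag; set z := (X in _ = (_ - X)%N).
  apply/eqP; rewrite -(eqn_add2r z); apply/eqP; rewrite /z.
  rewrite subnK -?big_split /=; last first.
    by rewrite -[leqRHS]card_ord -sum1_card leq_sum// => i _; case: (_ != _).
  rewrite -[RHS]card_ord -sum1_card; apply: eq_bigr => i _.
  by rewrite !mxE subr_eq0; case: (D 0 i == t).
have ss : gen_spectrum A B s.
  split; first exact/sort_sorted/le_total.
  by split => //; rewrite size_sort size_map size_enum_ord.
rewrite /gen_eigenvalue (xget_subset1 _ ss) //.
move=> s1 s2 [so1 [_ c1]] [so2 [_ c2]].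
apply: (sorted_eq le_trans le_anti) => //.
by rewrite /perm_eq; apply/allP => t _; rewrite /= c1 c2.
Qed.

(** For [t >= 0], the eigenvectors of [(A, B2)] with eigenvalue at most [t] span
    a space on which [A - t B2], hence [A - t B1], is nonpositive, whereas
    [A - t B1] is positive definite on the span of the eigenvectors of [(A, B1)]
    with eigenvalue above [t]: the two spaces are in direct sum. *)
Lemma pencil_count (R : realType) (n : nat) (A B1 B2 P1 P2 : 'M[R]_n)
    (D1 D2 : 'rV[R]_n) (t : R) :
  P1 *m B1 *m P1^T = 1%:M -> P1 *m A *m P1^T = diag_mx D1 ->
  P2 *m B2 *m P2^T = 1%:M -> P2 *m A *m P2^T = diag_mx D2 ->
  (forall v, qform B2 v <= qform B1 v) -> 0 <= t ->
  (\sum_(i < n) (D2 0%R i <= t)%R <= \sum_(i < n) (D1 0%R i <= t)%R)%N.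
Proof.
move=> PB1 PA1 PB2 PA2 B12 t0.
have uP1 : P1 \in unitmx by move: PB1; rewrite -mulmxA => /mulmx1_unit[].
have uP2 : P2 \in unitmx by move: PB2; rewrite -mulmxA => /mulmx1_unit[].
(* The row spaces of [diag_mx d2 *m P2] and [diag_mx d1 *m P1] are the two spans. *)
pose d2 : 'rV[R]_n := \row_i (D2 0 i <= t)%R%:R.
pose d1 : 'rV[R]_n := \row_i (~~ (D1 0 i <= t)%R)%:R.
have form (B P : 'M[R]_n) (D x : 'rV[R]_n) :
    P *m B *m P^T = 1%:M -> P *m A *m P^T = diag_mx D ->
    qform (A - t *: B) (x *m P) = \sum_i x 0 i ^+ 2 * (D 0 i - t).
  move=> PB PA; rewrite qformB qformZ !qform_mul PA PB /qform mulmx1.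
  rewrite mul_mx_diag !mxE mulr_sumr -sumrB; apply: eq_bigr => i _; rewrite !mxE; ring.
have cap0 : ((diag_mx d2 *m P2) :&: (diag_mx d1 *m P1) = 0)%MS.
  apply/eqP/rowV0P => v; rewrite sub_capmx => /andP[/submxP[x vx] /submxP[y vy]].
  pose x' := x *m diag_mx d2; pose y' := y *m diag_mx d1.
  have vx' : v = x' *m P2 by rewrite vx mulmxA.
  have vy' : v = y' *m P1 by rewrite vy mulmxA.
  have le0 : qform (A - t *: B2) v <= 0.
    rewrite vx' (form _ _ _ _ PB2 PA2); apply: sumr_le0 => i _.
    rewrite /x' mul_mx_diag !mxE.
    case: (leP (D2 0 i) t) => h; last by rewrite mulr0 expr0n mul0r.
    by rewrite mulr_ge0_le0 ?sqr_ge0// subr_le0.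
  have h1 i : 0 <= y' 0 i ^+ 2 * (D1 0 i - t).
    rewrite /y' mul_mx_diag !mxE.
    case: (leP (D1 0 i) t) => h /=; first by rewrite mulr0 expr0n mul0r.
    by rewrite mulr_ge0 ?sqr_ge0// subr_ge0 ltW.
  have : qform (A - t *: B1) v = 0.
    apply: le_anti; apply/andP; split.
      apply: le_trans le0; rewrite !qformB !qformZ lerD2l lerN2.
      by rewrite ler_wpM2l.
    by rewrite vy' (form _ _ _ _ PB1 PA1) sumr_ge0.
  rewrite vy' (form _ _ _ _ PB1 PA1) => /psumr_eq0P hy.
  suff -> : y' = 0 by rewrite mul0mx.
  apply/matrixP => i j; rewrite !ord1 [RHS]mxE.
  have := hy (fun i _ => h1 i) j isT; rewrite /y' mul_mx_diag !mxE.
  case: leP => h /=; first by rewrite mulr0.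
  by move/eqP; rewrite mulr1 mulf_eq0 sqrf_eq0 subr_eq0 (gt_eqF h) orbF => /eqP.
have := mxrank_disjoint_sum cap0.
rewrite !mxrankMfree ?row_free_unit// !mxrank_diag => e.
have := rank_leq_col (diag_mx d2 *m P2 + diag_mx d1 *m P1)%MS; rewrite e.
have -> : (\sum_i (d2 0%R i != 0%R))%N = (\sum_i (D2 0%R i <= t)%R)%N.
  by apply: eq_bigr => i _; rewrite mxE; case: leP; rewrite ?eqxx ?oner_eq0.
have -> : (\sum_i (d1 0%R i != 0%R))%N = (\sum_i ~~ (D1 0%R i <= t)%R)%N.
  by apply: eq_bigr => i _; rewrite mxE; case: leP; rewrite ?eqxx ?oner_eq0.
have : (\sum_i ~~ (D1 0%R i <= t)%R + \sum_i (D1 0%R i <= t)%R = n)%N.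
  rewrite -big_split -[RHS]card_ord -sum1_card; apply: eq_bigr => i _ /=.
  by case: leP.
move=> e1 e2; have := leq_trans e2 (eq_leq (esym e1)).
by rewrite addnC leq_add2l.
Qed.

Lemma sorted_count_le (R : realType) (s1 s2 : seq R) (k : nat) :
  sorted <=%R s1 -> sorted <=%R s2 -> (k < size s2)%N -> size s1 = size s2 ->
  (count (fun x => x <= nth 0 s2 k)%R s2 <= count (fun x => x <= nth 0 s2 k)%R s1)%N ->
  nth 0 s1 k <= nth 0 s2 k.
Proof.
move=> o1 o2 ks e; set t := nth 0 s2 k; apply: contraTle => h; rewrite -ltnNge.
apply: (@leq_trans k.+1).
  rewrite -(cat_take_drop k s1) count_cat ltnS.
  suff -> : count (fun x => x <= t) (drop k s1) = 0%N.
    rewrite addn0 (leq_trans (count_size _ _))// size_take; case: ltnP => //.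
  apply/eqP; rewrite -leqn0 leqNgt -has_count; apply/hasPn => x /(nthP 0)[j].
  rewrite size_drop nth_drop => jk <-; rewrite -ltNge (lt_le_trans h)//.
  by apply: (sorted_leq_nth le_trans le_refl) => //; rewrite ?inE ?leq_addr -?ltn_subRL// e.
rewrite -(cat_take_drop k.+1 s2) count_cat -[leqLHS]addn0 leq_add//.
rewrite -[leqLHS](size_takel ks) eq_leq//; apply/esym/eqP.
rewrite -all_count; apply/allP => x /(nthP 0)[j].
rewrite size_takel// => jk <-; rewrite nth_take//.
by apply: (sorted_leq_nth le_trans le_refl) => //; rewrite ?inE (leq_trans jk).
Qed.

(** [pencil_count] is applied to [t], the [k]-th eigenvalue of [(A, B2)], which is
    nonnegative because [A] is. *)
Lemma gen_eigenvalue_anti (R : realType) (n : nat) (A B1 B2 : 'M[R]_n) (k : 'I_n) :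
  A^T = A -> (forall v, 0 <= qform A v) -> posdefmx B1 -> posdefmx B2 ->
  (forall v, qform B2 v <= qform B1 v) ->
  gen_eigenvalue A B1 k <= gen_eigenvalue A B2 k.
Proof.
move=> sA A0 pB1 pB2 B12.
have [P1 [D1 [PB1 PA1]]] := pencil_diag sA pB1.
have [P2 [D2 [PB2 PA2]]] := pencil_diag sA pB2.
rewrite (pencil_spectrum k PB1 PA1) (pencil_spectrum k PB2 PA2).
have sz (D : 'rV[R]_n) : size (sort <=%R [seq D 0 i | i <- enum 'I_n]) = n.
  by rewrite size_sort size_map size_enum_ord.
apply: sorted_count_le; rewrite ?sz ?sort_sorted//; try exact: le_total.
rewrite !count_sort !count_sum; apply: (pencil_count PB1 PA1 PB2 PA2) => //.
set t := nth _ _ _; have : t \in sort <=%R [seq D2 0 i | i <- enum 'I_n].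
  by rewrite mem_nth// sz.
rewrite mem_sort => /mapP[i _ ->].
have := A0 (delta_mx 0 i *m P2).
by rewrite qform_mul PA2 qform_delta.
Qed.

(** * Tensor products of quadratic forms *)

Lemma psdmx_qform (R : realType) (n : nat) (A : 'M[R]_n) :
  psdmx A <-> A^T = A /\ forall v, 0 <= qform A v.
Proof.
split=> -[sA A0]; split=> // v; last by have := A0 v^T; rewrite /qform trmxK.
by have := A0 v^T; rewrite /qform trmxK.
Qed.

Lemma qform1 (R : realType) (n : nat) (v : 'rV[R]_n) :
  qform 1%:M v = \sum_i v 0 i ^+ 2.
Proof. by rewrite /qform mulmx1 mxE; apply: eq_bigr => i _; rewrite mxE expr2. Qed.

Lemma posdef1 (R : realType) (n : nat) : posdefmx (1%:M : 'M[R]_n).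
Proof.
split=> [|v v0]; first exact: trmx1.
have h (i : 'I_n) : true -> 0 <= v 0 i ^+ 2 by move=> _; exact: sqr_ge0.
rewrite qform1 lt_def sumr_ge0 ?andbT//; apply: contra v0.
move=> /eqP/(psumr_eq0P h) v0; apply/eqP/rowP => i.
by rewrite mxE; apply/eqP; rewrite -sqrf_eq0 v0.
Qed.

(** The square root of the diagonal form in an orthonormal eigenbasis. *)
Lemma psdmx_gram (R : realType) (n : nat) (A : 'M[R]_n) :
  psdmx A -> exists G : 'M[R]_n, A = G^T *m G.
Proof.
move=> /psdmx_qform[sA A0].
have [P [D []]] := pencil_diag sA (posdef1 R n); rewrite mulmx1 => PP PA.
have D0 i : 0 <= D 0 i.
  have := A0 (delta_mx 0 i *m P); by rewrite qform_mul PA qform_delta.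
exists (diag_mx (\row_i Num.sqrt (D 0 i)) *m P).
have PP' := mulmx1C PP.
rewrite trmx_mul tr_diag_mx mulmxA -(mulmxA P^T) mulmx_diag.
rewrite (_ : (\row_i _ : 'rV_n) = D); last first.
  by apply/rowP => i; rewrite !mxE -expr2 sqr_sqrtr.
by rewrite -PA !mulmxA PP' mul1mx -mulmxA PP' mulmx1.
Qed.

(** The quadratic form of the Kronecker product of the [A j], in coordinates
    indexed by multi-indices. *)
Definition tensor_form (R : realType) (d m : nat) (A : 'I_d -> 'M[R]_m)
    (c : {ffun 'I_d -> 'I_m} -> R) : R :=
  \sum_k \sum_l c k * c l * \prod_j A j (k j) (l j).

(** With Gram factorizations [A j = (G j)^T *m G j], the form is the sum over
    multi-indices [s] of the squares of [\sum_k c k * \prod_j G j (s j) (k j)]. *)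
Lemma tensor_form_ge0 (R : realType) (d m : nat) (A : 'I_d -> 'M[R]_m) c :
  (forall j, psdmx (A j)) -> 0 <= tensor_form A c.
Proof.
move=> h.
pose G j := sval (cid (psdmx_gram (h j))).
have GE j : A j = (G j)^T *m G j := svalP (cid (psdmx_gram (h j))).
have -> : tensor_form A c =
    \sum_(s : {ffun 'I_d -> 'I_m}) (\sum_k c k * \prod_j G j (s j) (k j)) ^+ 2.
  under [RHS]eq_bigr do rewrite expr2 big_distrlr.
  rewrite [RHS]exchange_big; apply: eq_bigr => k _ /=.
  rewrite [RHS]exchange_big; apply: eq_bigr => l _ /=.
  rewrite (eq_bigr (fun j => \sum_s G j s (k j) * G j s (l j))); last first.
    by move=> j _; rewrite GE mxE; apply: eq_bigr => s _; rewrite mxE.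
  rewrite bigA_distr_bigA mulr_sumr; apply: eq_bigr => s _ /=.
  by rewrite big_split /=; ring.
by apply: sumr_ge0 => s _; apply: sqr_ge0.
Qed.

(** Replacing the factors one at a time changes the form by a tensor product
    that has the nonnegative factor [A - B] at one place. *)
Lemma tensor_form_le (R : realType) (d m : nat) (A B : 'M[R]_m) c :
  psdmx B -> loewner_ge A B ->
  tensor_form (fun _ : 'I_d => B) c <= tensor_form (fun _ : 'I_d => A) c.
Proof.
move=> B0 AB0.
have A0 : psdmx A.
  move/psdmx_qform : AB0 => [sAB AB0]; move/psdmx_qform : B0 => [sB B0].
  apply/psdmx_qform; split => [|v].
    by move: sAB; rewrite linearB /= sB => /addIr.
  by have := AB0 v; have := B0 v; rewrite qformB; lra.
(* The first [i] factors have been replaced. *)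
pose H (i : nat) (j : 'I_d) := if (j < i)%N then A else B.
have HS (i : 'I_d) : tensor_form (H i) c <= tensor_form (H i.+1) c.
  rewrite -subr_ge0.
  pose D j := if j == i then A - B else H i j.
  suff -> : tensor_form (H i.+1) c - tensor_form (H i) c = tensor_form D c.
    by apply: tensor_form_ge0 => j; rewrite /D /H; case: eqP => // _; case: ifP.
  rewrite /tensor_form -sumrB; apply: eq_bigr => k _.
  rewrite -sumrB; apply: eq_bigr => l _; rewrite -mulrBr; congr (_ * _).
  rewrite (bigD1 i)//= [X in _ - X](bigD1 i)//= [RHS](bigD1 i)//=.
  rewrite /D eqxx /H ltnSn ltnn !mxE mulrBl.
  congr (_ * _ - _ * _); apply: eq_bigr => j ji; rewrite (negbTE ji)//.
  by rewrite ltnS leq_eqVlt (inj_eq val_inj) (negbTE ji).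
have Hi i : (i <= d)%N -> tensor_form (H 0%N) c <= tensor_form (H i) c.
  elim: i => // i IH id; apply: le_trans (IH (ltnW id)) _.
  exact: (HS (Ordinal id)).
have := Hi d (leqnn d).
rewrite (_ : H 0%N = fun=> B); last by apply/funext.
by rewrite (_ : H d = fun=> A)//; apply/funext => j; rewrite /H ltn_ord.
Qed.

Lemma ffun_neq (I : finType) (T : eqType) (k l : {ffun I -> T}) :
  k != l -> exists i, k i != l i.
Proof.
move=> kl; apply/existsP; apply: contraNT kl; rewrite negb_exists => /forallP h.
by apply/eqP/ffunP => i; have := h i; rewrite negbK => /eqP.
Qed.

Lemma tensor_form_scalar (R : realType) (d m : nat) (e : R) c :
  tensor_form (fun _ : 'I_d => (e%:M : 'M[R]_m)) c = \sum_k e ^+ d * c k ^+ 2.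
Proof.
apply: eq_bigr => k _; rewrite (bigD1 k)//= [X in _ + X]big1 => [|l lk].
  rewrite addr0 (eq_bigr (fun=> e)) => [|j _]; last by rewrite mxE eqxx.
  by rewrite prodr_const card_ord; ring.
have [j kj] : exists j, k j != l j by apply: ffun_neq; rewrite eq_sym.
by rewrite (bigD1 j)//= mxE (negbTE kj) mulr0n mul0r mulr0.
Qed.

Lemma posdef_psd (R : realType) (n : nat) (A : 'M[R]_n) : posdefmx A -> psdmx A.
Proof.
move=> [sA A0]; apply/psdmx_qform; split => // v.
by have [->|/A0/ltW//] := eqVneq v 0; rewrite /qform !mul0mx mxE.
Qed.

(** This turns positive definiteness into an inequality with a multiple of the
    identity, whose tensor powers are explicit; take the least eigenvalue. *)
Lemma posdef_ge_scalar (R : realType) (n : nat) (A : 'M[R]_n) :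
  posdefmx A -> exists2 e : R, 0 < e & loewner_ge A e%:M.
Proof.
move=> [sA A0]; have [P [D []]] := pencil_diag sA (posdef1 R n).
rewrite mulmx1 => PP PA.
have D0 i : 0 < D 0 i.
  have := A0 (delta_mx 0 i *m P); rewrite qform_mul PA qform_delta; apply.
  apply/eqP => /(congr1 (mulmx^~ P^T)); rewrite mul0mx -mulmxA PP mulmx1.
  by move/rowP/(_ i)/eqP; rewrite !mxE !eqxx oner_eq0.
exists (\big[Num.min/1]_i D 0 i).
  by apply: lt_bigmin => // i _; exact: D0.
set e := \big[_/_]_i _.
apply/psdmx_qform; split=> [|v]; first by rewrite linearB /= sA tr_scalar_mx.
rewrite qformB -scalemx1 qformZ subr_ge0.
have -> : v = (v *m P^T) *m P by rewrite -mulmxA (mulmx1C PP) mulmx1.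
rewrite !(qform_mul _ P) PA mulmx1 PP; move: (v *m P^T) => y.
rewrite qform1 /qform mul_mx_diag mxE mulr_sumr.
apply: ler_sum => i _; rewrite !mxE mulrAC -expr2 mulrC.
rewrite ler_wpM2l ?sqr_ge0// /e.
by apply: bigmin_le_cond.
Qed.

Lemma tensor_form_gt0 (R : realType) (d m : nat) (A : 'M[R]_m) c :
  posdefmx A -> (exists k, c k != 0) -> 0 < tensor_form (fun _ : 'I_d => A) c.
Proof.
move=> pA [k ck]; have [e e0 Ae] := posdef_ge_scalar pA.
apply: lt_le_trans (tensor_form_le _ _ Ae); last first.
  apply/psdmx_qform; split=> [|v]; first exact: tr_scalar_mx.
  rewrite -scalemx1 qformZ qform1 mulr_ge0 ?(ltW e0)// sumr_ge0// => i _.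
  exact: sqr_ge0.
rewrite tensor_form_scalar (bigD1 k)//= ltr_pwDl//.
  by rewrite mulr_gt0 ?(exprn_gt0 _ e0)// exprn_even_gt0//= ck.
by apply: sumr_ge0 => l _; rewrite mulr_ge0 ?sqr_ge0 ?exprn_ge0// ltW.
Qed.

(** * Gauss-Lobatto quadrature *)

Definition polyint (R : realType) (q : {poly R}) : R :=
  \int[lebesgue_measure]_(t in `[-1, 1]) q.[t].

Section polyint.
Context {R : realType}.
Implicit Types q f g s : {poly R}.

Lemma integrable_horner q :
  lebesgue_measure.-integrable `[(-1 : R), 1] (EFin \o horner q).
Proof.
apply: continuous_compact_integrable; first exact: segment_compact.
by apply: continuous_subspaceT => x; exact: continuous_horner.
Qed.

Lemma polyintD f g : polyint (f + g) = polyint f + polyint g.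
Proof.
rewrite /polyint -RintegralD//; try exact: integrable_horner.
by apply: eq_Rintegral => t _; rewrite hornerD.
Qed.

Lemma polyintZ a f : polyint (a *: f) = a * polyint f.
Proof.
rewrite /polyint -RintegralZl//; last exact: integrable_horner.
by apply: eq_Rintegral => t _; rewrite hornerZ.
Qed.

Lemma polyintB f g : polyint (f - g) = polyint f - polyint g.
Proof. by rewrite polyintD -scaleN1r polyintZ mulN1r. Qed.

Lemma polyint_sum (I : finType) (F : I -> {poly R}) :
  polyint (\sum_i F i) = \sum_i polyint (F i).
Proof.
apply: (big_morph _ polyintD).
by rewrite -(scale0r 0) polyintZ mul0r.
Qed.

Lemma polyint_deriv q : polyint q^`() = q.[1] - q.[-1].
Proof.
rewrite /polyint /Rintegral (@continuous_FTC2 _ _ (horner q)) //.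
- by apply: continuous_subspaceT => x; exact: continuous_horner.
- split=> [x _| |]; first exact: derivable_horner.
    by apply: cvg_at_right_filter; exact: continuous_horner.
  by apply: cvg_at_left_filter; exact: continuous_horner.
- by move=> x _; rewrite derivE.
Qed.

Lemma polyint_ge0 q : (forall t, -1 <= t <= 1 -> 0 <= q.[t]) -> 0 <= polyint q.
Proof. by move=> q0; apply: Rintegral_ge0 => t /=; rewrite in_itv => /q0. Qed.

Lemma finite_roots q : q != 0 -> finite_set [set t | root q t].
Proof.
move=> q0; apply: contrapT => /(infinite_set_fset (size q))[B BA].
apply/negP; rewrite -ltnNge; apply: (max_poly_roots q0).
  by apply/allP => t tB; exact: BA.
exact: finmap.fset_uniq.
Qed.

(** The polynomial [q] vanishes almost everywhere on an interval of length 2; if it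
    were nonzero, its roots would form a finite, hence null, set. *)
Lemma polyint_sqr_eq0 q : polyint (q ^+ 2) = 0 -> q = 0.
Proof.
move=> I0; apply/eqP; apply: contraT => q0.
pose mu := @lebesgue_measure R.
have : (\int[mu]_(t in `[(-1)%R, 1%R]) `|(EFin \o horner (q ^+ 2)%R) t| = 0)%E.
  rewrite -[RHS]/((0 : R)%:E) -I0 /polyint /Rintegral fineK.
    apply: eq_integral => t _ /=.
    by rewrite ger0_norm// horner_exp sqr_ge0.
  exact: (integrable_fin_num _ (integrable_horner _)).
move/(ae_eq_integral_abs mu (measurable_itv _) _).1.
move/(_ (measurable_int _ (integrable_horner _))) => ae0.
have cr : countable [set t : R | root q t] by exact/finite_set_countable/finite_roots.
have r0 : mu.-negligible [set t : R | root q t].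
  apply/negligibleP; last exact: countable_lebesgue_measure0.
  by apply: countable_measurable => // t; exact: measurable_set1.
have /negligibleP : mu.-negligible `[(-1 : R), 1].
  apply: (negligibleS _ (negligibleU ae0 r0)) => t /= t11.
  have [qt|qt] := boolP (root q t); [by right|left => /(_ t11)/= [] /eqP].
  by rewrite horner_exp sqrf_eq0; apply/negP.
move=> /(_ (measurable_itv _)) e.
have := etrans (esym (lebesgue_measure_itv `[(-1 : R), 1])) e.
by rewrite /= lte_fin gtrN// -EFinB => -[]; lra.
Qed.

Lemma polyint_by_parts f g :
  f.[1] * g.[1] = 0 -> f.[-1] * g.[-1] = 0 ->
  polyint (f^`() * g) = - polyint (f * g^`()).
Proof.
move=> h1 hN1; apply/eqP; rewrite -addr_eq0 -polyintD -derivM polyint_deriv.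
by rewrite !hornerM h1 hN1 subrr.
Qed.

(** Each derivative lowers the multiplicity of the root [a] by at most one. *)
Lemma derivn_XsubC_exp (a : R) (m j : nat) u : (j <= m)%N ->
  exists g, (('X - a%:P) ^+ m * u)^`(j) = ('X - a%:P) ^+ (m - j) * g.
Proof.
elim: j => [|j IH] jm; first by exists u; rewrite subn0.
have [g gE] := IH (ltnW jm); rewrite derivnS gE.
have -> : (m - j)%N = (m - j.+1).+1 by lia.
exists (g *+ (m - j.+1).+1 + ('X - a%:P) * g^`()).
rewrite derivM deriv_exp derivXsubC /=; rewrite exprS; ring.
Qed.

Local Notation X21 := ('X^2 - 1 : {poly R}).

Lemma X21E : X21 = ('X - 1%:P) * ('X - (-1)%:P).
Proof. by rewrite polyCN opprK; ring. Qed.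

Lemma X21_1 : X21.[1] = 0.
Proof. by rewrite X21E hornerM hornerXsubC subrr mul0r. Qed.

Lemma X21_N1 : X21.[-1] = 0.
Proof. by rewrite X21E hornerM !hornerXsubC subrr mulr0. Qed.

Lemma derivn_X21_root (m j : nat) : (j < m)%N ->
  (X21 ^+ m)^`(j).[1] = 0 /\ (X21 ^+ m)^`(j).[-1] = 0.
Proof.
move=> jm; split; rewrite X21E exprMn; last rewrite mulrC.
  have [g ->] := derivn_XsubC_exp 1 (('X - (-1)%:P) ^+ m) (ltnW jm).
  by rewrite hornerM horner_exp hornerXsubC subrr expr0n subn_eq0 leqNgt jm mul0r.
have [g ->] := derivn_XsubC_exp (-1) (('X - 1%:P) ^+ m) (ltnW jm).
by rewrite hornerM horner_exp hornerXsubC subrr expr0n subn_eq0 leqNgt jm mul0r.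
Qed.

(** The [k]-th derivative of [(X^2 - 1)^m] is orthogonal to polynomials of
    degree less than [k]: integrate by parts [k] times. *)
Lemma derivn_X21_orth (m k : nat) g : (k <= m)%N -> (size g <= k)%N ->
  polyint ((X21 ^+ m)^`(k) * g) = 0.
Proof.
elim: k g => [|k IH] g km gk.
  move: gk; rewrite leqn0 size_poly_eq0 => /eqP ->.
  by rewrite mulr0 -(scale0r 0) polyintZ mul0r.
have [h1 h2] := derivn_X21_root km.
rewrite derivnS polyint_by_parts ?h1 ?h2 ?mul0r// IH ?oppr0 ?(ltnW km)//.
have [->|g0] := eqVneq g 0; first by rewrite deriv0 size_poly0.
by rewrite -ltnS (leq_trans (lt_size_deriv g0)).
Qed.

(** Orthogonality of the polynomial [(X^2 - 1) P_p'] that vanishes at the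
    Gauss-Lobatto nodes, from that of [P_p]. *)
Lemma legendre_deriv_orth p s : (size s <= p.-1)%N ->
  polyint (X21 * (legendre R p)^`() * s) = 0.
Proof.
move=> sp; rewrite mulrAC mulrC polyint_by_parts; first last.
- by rewrite hornerM X21_N1 mul0r mulr0.
- by rewrite hornerM X21_1 mul0r mulr0.
rewrite /legendre -scalerAl polyintZ derivn_X21_orth ?mulr0 ?oppr0//.
have [->|s0] := eqVneq s 0; first by rewrite mulr0 deriv0 size_poly0.
have X0 : X21 != 0 by rewrite -size_poly_eq0 (_ : 1 = 1%:P)// size_XnsubC.
rewrite -ltnS (leq_trans (lt_size_deriv _))// ?mulf_neq0//.
rewrite (leq_trans (size_polyMleq _ _))// (_ : 1 = 1%:P)// size_XnsubC//=.
have : (0 < size s)%N by rewrite lt0n size_poly_eq0.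
move: sp; move: (size s) => k; lia.
Qed.

(** The leading coefficient: it comes from that of the monic polynomial
    [(X^2 - 1)^p], differentiated [p] times. *)
Lemma legendre_coef p : (legendre R p)`_p != 0.
Proof.
rewrite /legendre coefZ coef_derivn -[X in _ * X]mulr_natr.
apply: mulf_neq0; last apply: mulf_neq0.
- have f0 : p`!%:R != 0 :> R by rewrite pnatr_eq0 -lt0n fact_gt0.
  have e0 : 2 ^+ p != 0 :> R by rewrite expf_neq0// pnatr_eq0.
  by rewrite invr_eq0 mulf_neq0.
- have X1 : X21 \is monic by rewrite (_ : 1 = 1%:P) ?monicXnsubC.
  have := monic_exp p X1; rewrite monicE lead_coefE.
  rewrite size_exp (_ : 1 = 1%:P)// size_XnsubC//= mul2n -addnn => /eqP ->.
  exact: oner_neq0.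
- by rewrite pnatr_eq0 -lt0n ffact_gt0 leq_addr.
Qed.

Lemma size_legendre p : size (legendre R p) = p.+1.
Proof.
apply/eqP; rewrite eqn_leq; apply/andP; split; last first.
  by rewrite ltnNge; apply: contraNN (legendre_coef p) => /leq_sizeP ->.
apply/leq_sizeP => j pj; rewrite /legendre coefZ coef_derivn nth_default ?mul0rn ?mulr0//.
rewrite (leq_trans (size_exp_leq _ _))// (_ : 1 = 1%:P)// size_XnsubC//=.
lia.
Qed.
End polyint.

Definition lagrange_poly (R : realType) (p : nat) (xi : 'I_p.+1 -> R) a : {poly R} :=
  \prod_(b < p.+1 | b != a) ((xi a - xi b)^-1 *: ('X - (xi b)%:P)).

Definition lagrange_gram (R : realType) (p : nat) (xi : 'I_p.+1 -> R) : 'M[R]_p.+1 :=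
  \matrix_(a, b) polyint (lagrange_poly xi a * lagrange_poly xi b).

Section quadrature.
Context {R : realType} {p : nat} (xi w : 'I_p.+1 -> R).
Local Notation L := (lagrange_poly xi).

Lemma horner_lagrange_poly a t : (L a).[t] = Defs.lagrange xi a t.
Proof.
rewrite /Defs.lagrange horner_prod; apply: eq_bigr => b _.
by rewrite hornerZ hornerXsubC mulrC.
Qed.

Lemma size_lagrange_poly a : (size (L a) <= p.+1)%N.
Proof.
rewrite /L (leq_trans (size_prod_leq _ _))//.
have : (\sum_(i < p.+1 | i != a) size ((xi a - xi i)^-1 *: ('X - (xi i)%:P)) <=
    \sum_(i < p.+1 | i != a) 2)%N.
  apply: leq_sum => b _; rewrite (leq_trans (size_scale_leq _ _))//.
  by rewrite size_XsubC.
rewrite sum_nat_const.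
have -> : #|[pred i | i != a]| = p by rewrite cardC1 card_ord.
by move=> h; rewrite leq_subLR addnS ltnS addnn -muln2.
Qed.

Hypothesis xi_inj : injective xi.

Lemma lagrange_node a b : (L a).[xi b] = (a == b)%:R.
Proof.
rewrite horner_lagrange_poly /Defs.lagrange; have [->|ab] := eqVneq a b.
  by apply: big1 => c cb; rewrite divff// subr_eq0 (inj_eq xi_inj) eq_sym.
by rewrite (bigD1 b) 1?eq_sym//= subrr !mul0r.
Qed.

Lemma uniq_nodes : uniq [seq xi a | a <- enum 'I_p.+1].
Proof. by rewrite map_inj_uniq ?enum_uniq. Qed.

(** The difference has degree at most [p] and [p + 1] distinct roots. *)
Lemma lagrange_interpolation (q : {poly R}) : (size q <= p.+1)%N ->
  q = \sum_a q.[xi a] *: L a.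
Proof.
move=> qp; apply/eqP; rewrite -subr_eq0; apply: contraT => d0.
set d := q - _ in d0.
have := max_poly_roots d0 _ uniq_nodes; rewrite size_map size_enum_ord => h.
have : (p.+1 < size d)%N.
  apply: h; apply/allP => _ /mapP[b _ ->]; rewrite /root /d hornerD hornerN horner_sum.
  rewrite (bigD1 b)//= hornerZ lagrange_node eqxx mulr1 big1 ?addr0 ?subrr// => a ab.
  by rewrite hornerZ lagrange_node (negbTE ab) mulr0.
rewrite ltnNge => /negP[]; rewrite (leq_trans (size_polyD _ _))// geq_max qp size_polyN.
apply: (leq_trans (size_sum _ _ _)); apply/bigmax_leqP => a _.
by rewrite (leq_trans (size_scale_leq _ _))// size_lagrange_poly.
Qed.

Hypothesis p_gt0 : (0 < p)%N.
Hypothesis GL : gauss_lobatto xi w.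

Local Notation P' := (legendre R p)^`().

Lemma weightE a : w a = polyint (L a).
Proof.
have [_ _ _ _ ->] := GL; apply: eq_Rintegral => t _.
by rewrite horner_lagrange_poly.
Qed.

Lemma size_legendre_deriv : size P' = p.
Proof.
apply/eqP; rewrite eqn_leq; apply/andP; split.
  rewrite -ltnS -(size_legendre (R := R) p); apply: lt_size_deriv.
  by rewrite -size_poly_eq0 size_legendre.
rewrite leqNgt; apply/negP => h.
have : P'`_p.-1 = 0 by rewrite nth_default// -ltnS prednK.
rewrite coef_deriv prednK// -mulr_natr => /eqP.
by rewrite mulf_eq0 (negbTE (legendre_coef (R := R) p)) pnatr_eq0 gtn_eqF.
Qed.

Local Notation X21 := ('X^2 - 1 : {poly R}).

Lemma size_X21 : size X21 = 3.
Proof. by rewrite (_ : 1 = 1%:P)// size_XnsubC. Qed.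

Lemma legendre_deriv_neq0 : P' != 0.
Proof. by rewrite -size_poly_eq0 size_legendre_deriv -lt0n. Qed.

Lemma X21_neq0 : X21 != 0.
Proof. by rewrite -size_poly_eq0 size_X21. Qed.

Lemma root_node a : root (X21 * P') (xi a).
Proof.
have [_ x0 x1 xr _] := GL; rewrite rootM.
have [->|a0] := eqVneq a ord0; first by rewrite x0 /root X21_N1 eqxx.
have [->|am] := eqVneq a ord_max; first by rewrite x1 /root X21_1 eqxx.
by rewrite xr// orbT.
Qed.

Definition node_poly : {poly R} := \prod_a ('X - (xi a)%:P).

Lemma size_node_poly : size node_poly = p.+2.
Proof. by rewrite /node_poly -big_enum size_prod_XsubC size_enum_ord. Qed.

(** Both sides have degree [p + 1] and vanish at the [p + 1] nodes. *)
Lemma node_polyE : X21 * P' = lead_coef (X21 * P') *: node_poly.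
Proof.
rewrite [LHS](@all_roots_prod_XsubC _ _ [seq xi a | a <- enum 'I_p.+1]).
- by rewrite big_map /node_poly big_enum.
- rewrite size_mul ?X21_neq0 ?legendre_deriv_neq0// size_X21 size_legendre_deriv.
  by rewrite size_map size_enum_ord.
- by apply/allP => _ /mapP[a _ ->]; exact: root_node.
- by rewrite uniq_rootsE uniq_nodes.
Qed.

(** Division by the node polynomial, whose multiples by polynomials of degree at
    most [p - 2] have zero integral. *)
Lemma quadrature_exact (q : {poly R}) : (size q <= p.*2)%N ->
  polyint q = \sum_a w a * q.[xi a].
Proof.
move=> qp; pose c := lead_coef (X21 * P').
have c0 : c != 0 by rewrite lead_coef_eq0 mulf_neq0 ?X21_neq0 ?legendre_deriv_neq0.
have NE : node_poly = c^-1 *: (X21 * P').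
  by rewrite node_polyE -/c scalerA mulVf// scale1r.
have N0 : node_poly != 0 by rewrite -size_poly_eq0 size_node_poly.
have qE := divp_eq q node_poly.
set s := q %/ node_poly in qE; set r := q %% node_poly in qE.
have rn : (size r <= p.+1)%N by rewrite -ltnS -size_node_poly ltn_modp.
have -> : polyint q = polyint r.
  rewrite qE polyintD mulrC NE -scalerAl polyintZ legendre_deriv_orth ?mulr0 ?add0r//.
  rewrite /s size_divp// size_node_poly /=.
  by move: qp p_gt0; move: (size q) => k; lia.
have qr a : q.[xi a] = r.[xi a].
  rewrite qE hornerD hornerM NE hornerZ (rootP (root_node a)).
  by rewrite mulr0 mulr0 add0r.
rewrite [in LHS](lagrange_interpolation rn) polyint_sum; apply: eq_bigr => a _.
by rewrite polyintZ weightE mulrC qr.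
Qed.

(** The rule is exact on [q^2 - g T], where [T = (X^2 - 1) P_p'^2] and [g >= 0] is
    chosen to cancel the terms of degree [2p]. The rule gives [T] the value 0, and
    the integral of [T] is nonpositive. *)
Lemma quadrature_sqr_ge (q : {poly R}) : (size q <= p.+1)%N ->
  polyint (q ^+ 2) <= \sum_a w a * q.[xi a] ^+ 2.
Proof.
move=> qp; pose T := X21 * P' ^+ 2.
have sT : size T = (p.*2).+1.
  rewrite /T size_mul ?X21_neq0 ?expf_neq0 ?legendre_deriv_neq0// size_X21.
  have := size_exp P' 2; rewrite size_legendre_deriv.
  have : (0 < size (P' ^+ 2))%N by rewrite lt0n size_poly_eq0 expf_neq0 ?legendre_deriv_neq0.
  by move: (size (P' ^+ 2)) p_gt0 => k; lia.
have T_gt0 : 0 < T`_(p.*2).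
  have := lead_coefE T; rewrite sT /= => <-; rewrite lead_coefM lead_coef_exp.
  rewrite (_ : 1 = 1%:P)// lead_coefXnsubC// mul1r.
  by rewrite exprn_even_gt0//= lead_coef_eq0 legendre_deriv_neq0.
have sq2 : ((size (q ^+ 2)).-1 = (size q).-1 * 2)%N by exact: size_exp.
(* This coefficient is the square of the leading one of [q], or zero. *)
have q2_ge0 : 0 <= (q ^+ 2)`_(p.*2).
  have [sq|sq] := ltnP (size q) p.+1.
    rewrite nth_default// (leq_trans (leqSpred _))// sq2.
    move: sq p_gt0; move: (size q) => k; lia.
  have := lead_coefE (q ^+ 2); rewrite sq2.
  have -> : ((size q).-1 * 2)%N = p.*2.
    by move: sq qp; move: (size q) => k; lia.
  by move=> <-; rewrite lead_coef_exp sqr_ge0.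
pose g := (q ^+ 2)`_(p.*2) / T`_(p.*2).
have g0 : 0 <= g by rewrite divr_ge0// ltW.
have sr : (size (q ^+ 2 - g *: T)%R <= p.*2)%N.
  apply/leq_sizeP => j; rewrite leq_eqVlt => /predU1P[<-|pj].
    by rewrite coefB coefZ /g divfK ?subrr// gt_eqF.
  rewrite coefB coefZ !nth_default ?mulr0 ?subrr ?sT//.
  rewrite (leq_trans (leqSpred _))// sq2.
  by move: qp pj; move: (size q) => k; lia.
have := quadrature_exact sr; rewrite polyintB polyintZ => /eqP; rewrite subr_eq => /eqP ->.
rewrite -lerBrDl [X in _ - X](eq_bigr (fun a => w a * q.[xi a] ^+ 2)) ?subrr.
  rewrite mulr_ge0_le0// -oppr_ge0 -mulN1r -polyintZ polyint_ge0// => t t11.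
  have XE : X21.[t] = t ^+ 2 - 1 by rewrite !hornerE.
  rewrite hornerZ /T hornerM horner_exp XE mulrA mulr_ge0 ?sqr_ge0//; nra.
move=> a _; rewrite hornerD hornerN hornerZ.
by rewrite /T [P' ^+ 2]expr2 mulrA [X in g * X]hornerM (rootP (root_node a))
  mul0r mulr0 subr0 horner_exp.
Qed.

Lemma lagrange_gramE (v : 'rV[R]_p.+1) :
  qform (lagrange_gram xi) v = polyint ((\sum_a v 0 a *: L a) ^+ 2).
Proof.
rewrite expr2 mulr_suml polyint_sum /qform mxE; under eq_bigr do rewrite mxE mulr_suml.
rewrite exchange_big; apply: eq_bigr => a _ /=.
rewrite mulr_sumr polyint_sum; apply: eq_bigr => b _.
by rewrite -[in RHS]scalerAr polyintZ -[in RHS]scalerAl polyintZ !mxE; ring.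
Qed.

Lemma lagrange_gram_sym : (lagrange_gram xi)^T = lagrange_gram xi.
Proof. by apply/matrixP => a b; rewrite !mxE mulrC. Qed.

Lemma lagrange_sum_node (v : 'rV[R]_p.+1) b : (\sum_a v 0 a *: L a).[xi b] = v 0 b.
Proof.
rewrite horner_sum (bigD1 b)//= hornerZ lagrange_node eqxx mulr1 big1 ?addr0// => a ab.
by rewrite hornerZ lagrange_node (negbTE ab) mulr0.
Qed.

Lemma lagrange_gram_posdef : posdefmx (lagrange_gram xi).
Proof.
split=> [|v v0]; first exact: lagrange_gram_sym.
rewrite lagrange_gramE lt_def polyint_ge0 ?andbT => [|t _]; last first.
  by rewrite horner_exp sqr_ge0.
apply: contra v0 => /eqP/polyint_sqr_eq0 q0; apply/eqP/rowP => b.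
by rewrite -lagrange_sum_node q0 horner0 mxE.
Qed.

Lemma lagrange_gram_le : loewner_ge (diag_mx (\row_a w a)) (lagrange_gram xi).
Proof.
apply/psdmx_qform; split=> [|v].
  by rewrite linearB /= tr_diag_mx lagrange_gram_sym.
rewrite qformB subr_ge0 lagrange_gramE.
apply: le_trans (quadrature_sqr_ge _) _.
  apply: (leq_trans (size_sum _ _ _)); apply/bigmax_leqP => a _.
  by rewrite (leq_trans (size_scale_leq _ _))// size_lagrange_poly.
rewrite /qform mul_mx_diag mxE; apply: ler_sum => a _.
by rewrite lagrange_sum_node !mxE mulrAC -expr2 mulrC.
Qed.

End quadrature.

(** * Affine changes of variables *)

Definition affine (R : realType) (d : nat) (A : 'M[R]_d) (b : 'rV[R]_d)
    (z : borel_rV R d) : borel_rV R d := z *m A + b.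

Lemma measurable_affine (R : realType) (d : nat) (A : 'M[R]_d) (b : 'rV[R]_d) :
  measurable_fun setT (affine A b).
Proof.
apply: measurable_fun_borel_rV => i; rewrite /affine.
apply: (eq_measurable_fun (fun z : borel_rV R d =>
    \sum_j (z : 'rV[R]_d) 0 j * A j i + b 0 i)).
  by move=> z _; rewrite !mxE.
apply: measurable_funD => //; apply: measurable_sum => j.
by apply: measurable_funM => //; exact: measurable_coord.
Qed.

Lemma measurable_affine_preimage (R : realType) (d : nat) (A : 'M[R]_d) b S :
  measurable S -> measurable (affine A b @^-1` S).
Proof. by move=> mS; rewrite -[X in measurable X]setTI; exact: measurable_affine. Qed.

(** The convention is that of an affine map [T] whose linear part has determinant
    [k] in absolute value: preimages under [T] have their volume divided by [k]. *)
Definition scales_volume (R : realType) (d : nat)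
    (T : borel_rV R d -> borel_rV R d) (k : R) : Prop :=
  forall S, measurable S ->
  (k%:E * lebesgue_rV R d (T @^-1` S) = lebesgue_rV R d S)%E.

Lemma scales_volume_affine_comp (R : realType) (d : nat) (A B : 'M[R]_d) a b k l :
  scales_volume (affine A a) k -> scales_volume (affine B b) l ->
  scales_volume (affine (A *m B) (a *m B + b)) (k * l).
Proof.
move=> hA hB S mS.
have -> : affine (A *m B) (a *m B + b) @^-1` S = affine A a @^-1` (affine B b @^-1` S).
  by apply/funext => z /=; rewrite /affine mulmxDl mulmxA addrA.
rewrite EFinM -(hB S mS) -(hA (affine B b @^-1` S)); last exact: measurable_affine_preimage.
by rewrite -muleA muleCA.
Qed.

(** Intervals of the form [`]x, y]] suffice, by uniqueness of Lebesgue measure; the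
    sign of [a] decides which end of the preimage is open. *)
Lemma lebesgue_scale (R : realType) (a b : R) (S : set (measurableTypeR R)) :
  a != 0 -> measurable S ->
  (`|a|%:E * lebesgue_measure [set t : measurableTypeR R | S (t * a + b)%R] =
   lebesgue_measure S)%E.
Proof.
move=> a0 mS.
have mf : measurable_fun [set: measurableTypeR R]
    (fun t : measurableTypeR R => (t * a + b : measurableTypeR R)).
  by apply: measurable_funD => //; apply: measurable_funM.
pose mu := mscale (NngNum (normr_ge0 a))
  (measure_function_pushforward__canonical__measure_function_Measure lebesgue_measure mf).
rewrite -[LHS]/(mu S); apply/esym; apply: lebesgue_measure_unique mS => _ [[x y] _ <-].
transitivity (`|a|%:E * lebesgue_measure
  [set t : measurableTypeR R | `]x, y]%classic (t * a + b)%R])%E; last by [].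
rewrite lebesgue_measure_itv/= lte_fin.
have [a_gt0|a_lt0|/eqP] := ltgtP 0 a; last by rewrite eq_sym (negbTE a0).
  rewrite [X in lebesgue_measure X](_ : _ = `](x - b) / a, (y - b) / a]%classic); last first.
    apply/seteqP; split=> t /=; rewrite !in_itv /= ltr_pdivrMr// ler_pdivlMr//.
      by rewrite ltrBlDr lerBrDr.
    by rewrite ltrBlDr lerBrDr.
  rewrite lebesgue_measure_itv/= lte_fin ltr_pM2r ?invr_gt0// ltrD2r.
  case: ifP => _; last by rewrite mule0.
  by rewrite gtr0_norm// -!EFinB -EFinM; congr (_%:E); field; rewrite gt_eqF.
rewrite [X in lebesgue_measure X](_ : _ = `[(y - b) / a, (x - b) / a[%classic); last first.
  apply/seteqP; split=> t /=; rewrite !in_itv /= ler_ndivrMr// ltr_ndivlMr//.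
    by rewrite ltrBlDr lerBrDr andbC.
  by rewrite ltrBlDr lerBrDr andbC.
rewrite lebesgue_measure_itv/= lte_fin ltr_nM2r ?invr_lt0// ltrD2r.
case: ifP => _; last by rewrite mule0.
by rewrite ltr0_norm// -!EFinB -EFinM; congr (_%:E); field; rewrite lt_eqF.
Qed.

Lemma measurable_cons_preimage (R : realType) (d : nat) (S : set (borel_rV R d.+1)) :
  measurable S -> measurable (@cons_rV R d @^-1` S).
Proof. by move=> mS; rewrite -[X in measurable X]setTI; exact: measurable_cons_rV. Qed.

Lemma lebesgue_rV_slices (R : realType) (d : nat) (S : set (borel_rV R d.+1)) :
  lebesgue_rV R d.+1 S =
  (\int[lebesgue_measure]_t lebesgue_rV R d [set x | S (cons_rV (t, x))])%E.
Proof.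
rewrite /= /lebesgue_cons /pushforward /product_measure1 /=.
apply: eq_integral => t _; congr (lebesgue_rV R d : set _ -> _).
by apply/seteqP; split=> x; rewrite /xsection /= inE.
Qed.

Lemma lebesgue_rV_lines (R : realType) (d : nat) (S : set (borel_rV R d.+1)) :
  measurable S ->
  lebesgue_rV R d.+1 S =
  (\int[lebesgue_rV R d]_x lebesgue_measure
     [set t : measurableTypeR R | S (cons_rV (t, x))])%E.
Proof.
move=> mS; rewrite /= /lebesgue_cons /pushforward.
rewrite (@product_measure_unique _ _ _ _ _ lebesgue_measure (lebesgue_rV R d)
  (lebesgue_measure \x^ lebesgue_rV R d)%E).
- apply: eq_integral => x _; congr (lebesgue_measure : set _ -> _).
  by apply/seteqP; split=> t; rewrite /ysection /= inE.
- by move=> A B mA mB; exact: product_measure2E.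
- exact: measurable_cons_preimage.
Qed.

Lemma measurable_slice (R : realType) (d : nat) (S : set (borel_rV R d.+1)) t :
  measurable S -> measurable [set x : borel_rV R d | S (cons_rV (t, x))].
Proof.
move=> /measurable_cons_preimage/(measurable_xsection t); congr measurable.
by apply/seteqP; split=> x; rewrite /xsection /= inE.
Qed.

Lemma measurable_line (R : realType) (d : nat) (S : set (borel_rV R d.+1)) x :
  measurable S -> measurable [set t : measurableTypeR R | S (cons_rV (t, x))].
Proof.
move=> /measurable_cons_preimage/(measurable_ysection x); congr measurable.
by apply/seteqP; split=> t; rewrite /ysection /= inE.
Qed.

Lemma measurable_slice_measure (R : realType) (d : nat) (S : set (borel_rV R d.+1)) :
  measurable S -> measurable_fun [set: measurableTypeR R]
    (fun t : measurableTypeR R => lebesgue_rV R d [set x | S (cons_rV (t, x))]).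
Proof.
move=> /measurable_cons_preimage/(measurable_fun_xsection (lebesgue_rV R d)).
apply: eq_measurable_fun => t _ /=; congr (lebesgue_rV R d : set _ -> _).
by apply/seteqP; split=> x; rewrite /xsection /= inE.
Qed.

Lemma measurable_line_measure (R : realType) (d : nat) (S : set (borel_rV R d.+1)) :
  measurable S -> measurable_fun [set: borel_rV R d]
    (fun x => lebesgue_measure [set t : measurableTypeR R | S (cons_rV (t, x))]).
Proof.
move=> /measurable_cons_preimage/(measurable_fun_ysection lebesgue_measure).
apply: eq_measurable_fun => x _ /=; congr (lebesgue_measure : set _ -> _).
by apply/seteqP; split=> t; rewrite /ysection /= inE.
Qed.

Lemma affine_cons (R : realType) (d : nat) (a c t : R) (u b x : 'rV[R]_d)
    (v : 'cV[R]_d) (D : 'M[R]_d) :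
  @affine R d.+1 (block_mx (a%:M : 'M[R]_1) u v D) (row_mx (c%:M : 'rV[R]_1) b)
    (@cons_rV R d (t, x)) =
  @cons_rV R d (t * a + (x *m v) 0 0 + c, x *m D + t *: u + b).
Proof.
transitivity (row_mx (t%:M : 'rV[R]_1) x *m block_mx (a%:M : 'M[R]_1) u v D +
  row_mx (c%:M : 'rV[R]_1) b); first by [].
rewrite mul_row_block add_row_mx [t%:M *m u]mul_scalar_mx (addrC (t *: u)).
by rewrite [X in _ + X + _](mx11_scalar (x *m v)) -scalar_mxM -!raddfD.
Qed.

(** Such a map sends each slice [t = cst] to itself, acting there by [D] followed by
    a translation that depends on [t]. *)
Lemma scales_volume_slices (R : realType) (d : nat) (D : 'M[R]_d) (u b : 'rV[R]_d) k :
  0 <= k -> (forall c, scales_volume (affine D c) k) ->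
  @scales_volume R d.+1 (@affine R d.+1 (block_mx (1%:M : 'M[R]_1) u 0 D)
    (row_mx ((0 : R)%:M : 'rV[R]_1) b)) k.
Proof.
move=> k0 hD S mS; rewrite !lebesgue_rV_slices -ge0_integralZl//; last first.
  apply: (@measurable_slice_measure _ _ (_ @^-1` S)).
  exact: measurable_affine_preimage.
apply: eq_integral => t _; rewrite -[RHS](hD (t *: u + b)); last exact: measurable_slice.
congr (_ * lebesgue_rV R d _)%E; apply/seteqP; split=> x /=.
all: by rewrite affine_cons mulmx0 mxE addr0 addr0 mulr1 /affine addrA.
Qed.

(** Such a map sends each line [x = cst] to itself, acting there by [a] followed by
    a translation that depends on [x]. *)
Lemma scales_volume_lines (R : realType) (d : nat) (a c : R) (v : 'cV[R]_d) :
  a != 0 ->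
  @scales_volume R d.+1 (@affine R d.+1 (block_mx (a%:M : 'M[R]_1) 0 v 1%:M)
    (row_mx (c%:M : 'rV[R]_1) 0)) `|a|.
Proof.
move=> a0 S mS; rewrite !lebesgue_rV_lines//; last exact: measurable_affine_preimage.
rewrite -ge0_integralZl//; last first.
  apply: (@measurable_line_measure _ _ (_ @^-1` S)).
  exact: measurable_affine_preimage.
apply: eq_integral => x _.
rewrite -[RHS](lebesgue_scale ((x *m v) 0 0 + c) a0); last exact: measurable_line.
congr (_ * lebesgue_measure _)%E; apply/seteqP; split=> t /=.
all: by rewrite affine_cons mulmx1 scaler0 !addr0 addrA.
Qed.

(** Gaussian elimination. When the upper left entry [a] of [A] is nonzero,
    [A = [[a, 0], [v, 1]] * [[1, u / a], [0, D]]] with [D] the Schur complement: the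
    first factor preserves lines, the second one slices. Otherwise a transvection
    [E] makes that entry nonzero. *)
Lemma scales_volume_det (R : realType) (d : nat) (A : 'M[R]_d) b :
  A \in unitmx -> scales_volume (affine A b) `|\det A|.
Proof.
elim: d A b => [|d IH] A b uA.
  move=> S mS; rewrite det_mx00 normr1 mul1e; congr (lebesgue_rV R 0 : set _ -> _).
  by apply/seteqP; split=> z /=; rewrite [affine A b z](_ : _ = z)//; apply/matrixP => i [].
have gauss (M : 'M[R]_(1 + d)) (e : 'rV[R]_(1 + d)) : M \in unitmx -> M 0 0 != 0 ->
    @scales_volume R d.+1 (@affine R d.+1 M e) `|\det M|.
  move=> uM M0; pose a := M 0 0.
  pose u := ursubmx M; pose v := dlsubmx M.
  pose D := drsubmx M - a^-1 *: (v *m u).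
  pose B1 : 'M[R]_(1 + d) := block_mx (1%:M : 'M[R]_1) (a^-1 *: u) 0 D.
  pose B2 : 'M[R]_(1 + d) := block_mx (a%:M : 'M[R]_1) 0 v 1%:M.
  have ME : M = B2 *m B1.
    rewrite /B1 /B2 mulmx_block !mul1mx !mulmx1 !mul0mx ?mulmx0 !addr0 ?add0r.
    rewrite mul_scalar_mx scalerA divff// scale1r -scalemxAr /D addrC subrK.
    rewrite -[LHS]submxK; congr block_mx.
    by apply/matrixP => i j; rewrite !ord1 !mxE eqxx mulr1n /a; congr (M _ _); exact: val_inj.
  have detM : \det M = a * \det D.
    by rewrite ME det_mulmx det_lblock det_ublock det_scalar1 !det1 mulr1 mul1r.
  have uD : D \in unitmx.
    by move: uM; rewrite !unitmxE detM unitrM => /andP[].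
  pose c := e 0 0; pose g := rsubmx e - (c * a^-1) *: u.
  (* Only translations along the lines, resp. the slices, are allowed in each
     factor; these two add up to the translation by [e]. *)
  have eE : e = row_mx c%:M 0 *m B1 + row_mx (0%:M : 'rV[R]_1) g.
    rewrite /B1 mul_row_block !mul0mx !addr0 mulmx1 add_row_mx.
    rewrite mul_scalar_mx scalerA /g [X in row_mx _ X]addrC subrK raddf0 addr0 -[LHS]hsubmxK.
    congr (row_mx _ _).
    by apply/matrixP => i j; rewrite !ord1 !mxE eqxx mulr1n /c; congr (e _ _); exact: val_inj.
  rewrite detM normrM ME eE.
  apply: (@scales_volume_affine_comp R d.+1 B2 B1); first exact: scales_volume_lines.
  by apply: scales_volume_slices => // c'; apply: IH.
have [A0|A0] := eqVneq (A 0 0) 0; last exact: gauss.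
have [j Aj] : exists j : 'I_d, (A : 'M[R]_(1 + d)) (rshift 1 j) 0 != 0.
  apply/existsP; apply: contraTT uA; rewrite negb_exists => /forallP h.
  rewrite unitmxE unitfE negbK (expand_det_col A 0) big1// => i _.
  have [->|[k ->]] : i = 0 \/ exists k : 'I_d, i = rshift 1 k.
    case: (split_ordP (i : 'I_(1 + d))) => k ->; last by right; exists k.
    by left; apply: val_inj; rewrite /= ord1.
    by rewrite A0 mul0r.
  by have := h k; rewrite negbK => /eqP ->; rewrite mul0r.
pose E (s : R) : 'M[R]_(1 + d) := block_mx (1%:M : 'M[R]_1) (s *: delta_mx 0 j) 0 1%:M.
have detE s : \det (E s) = 1 by rewrite det_ublock !det1 mulr1.
have E00 s i : E s 0 (lshift d i) = 1.
  transitivity (E s (lshift d 0) (lshift d i)); first by congr (E s _ _); exact: val_inj.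
  by rewrite block_mxEul ord1 mxE.
have E0j s k : E s 0 (rshift 1 k) = s * (k == j)%:R.
  transitivity (E s (lshift d 0) (rshift 1 k)); first by congr (E s _ _); exact: val_inj.
  by rewrite block_mxEur !mxE eqxx.
have EE : E (-1) *m E 1 = 1%:M.
  rewrite mulmx_block !mul1mx !mulmx1 !mul0mx !mulmx0 !addr0 add0r.
  by rewrite -scalerDl subrr scale0r -scalar_mx_block.
pose M : 'M[R]_(1 + d) := E 1 *m (A : 'M[R]_(1 + d)).
have AE : A = E (-1) *m M by rewrite /M mulmxA EE mul1mx.
have detM : \det M = \det A by rewrite det_mulmx detE mul1r.
rewrite AE -(add0r b) -(mul0mx _ M) det_mulmx normrM.
apply: (@scales_volume_affine_comp R d.+1 (E (-1)) M).
  apply: gauss; first by rewrite unitmxE detE unitr1.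
  have -> : E (-1) 0 0 = E (-1) 0 (lshift d 0) by congr (E (-1) _ _); exact: val_inj.
  by rewrite E00 oner_neq0.
apply: gauss; first by rewrite unitmxE detM -unitmxE.
rewrite mxE big_split_ord /= big_ord1 E00.
rewrite (_ : (A : 'M[R]_(1 + d)) (lshift d 0) 0 = 0); last first.
  by rewrite -A0; congr (A _ _); exact: val_inj.
rewrite mulr0 add0r (bigD1 j)//= E0j eqxx !mul1r big1 ?addr0// => k kj.
by rewrite E0j (negbTE kj) mulr0 mul0r.
Qed.

Lemma ge0_integral_affine (R : realType) (d : nat) (A : 'M[R]_d) b
    (D : set (borel_rV R d)) (f : borel_rV R d -> \bar R) :
  A \in unitmx -> measurable D -> measurable_fun D f ->
  (forall y, D y -> 0 <= f y)%E ->
  (\int[lebesgue_rV R d]_(y in D) f y =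
   `|\det A|%:E *
   \int[lebesgue_rV R d]_(z in affine A b @^-1` D) f (affine A b z))%E.
Proof.
move=> uA mD mf f0.
pose T := affine A b : borel_rV R d -> borel_rV R d.
have mT : measurable_fun setT T := measurable_affine A b.
pose nu := measure_function_pushforward__canonical__measure_function_Measure
  (lebesgue_rV R d) mT.
rewrite -(ge0_integral_pushforward mT)//; last by move=> y; rewrite inE => /f0.
rewrite -(@ge0_integral_mscale _ _ _ nu _ mD (NngNum (normr_ge0 (\det A))))//.
apply: eq_measure_integral => S mS _.
exact/esym/scales_volume_det.
Qed.

(** * Integrals of products of functions of one coordinate *)

Section product_integral.
Context d1 d2 (T1 : measurableType d1) (T2 : measurableType d2) (R : realType).
Variable m1 : {sigma_finite_measure set T1 -> \bar R}.
Variable m2 : {sigma_finite_measure set T2 -> \bar R}.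
Variables (f : T1 -> R) (g : T2 -> R).
Hypotheses (intf : m1.-integrable setT (EFin \o f))
  (intg : m2.-integrable setT (EFin \o g)).
Let fg (z : T1 * T2) := f z.1 * g z.2.

Lemma integrable_prod_mul : (m1 \x m2)%E.-integrable setT (EFin \o fg).
Proof.
have mf := measurable_int _ intf; have mg := measurable_int _ intg.
have mfg : measurable_fun setT (EFin \o fg).
  apply/measurable_EFinP; apply: measurable_funM.
    by apply: measurableT_comp; [exact/measurable_EFinP|exact: measurable_fst].
  by apply: measurableT_comp; [exact/measurable_EFinP|exact: measurable_snd].
apply/(integrable12ltyP _ _ mfg).
have /integrableP[_ f_fin] := intf; have /integrableP[_ g_fin] := intg.
have af : measurable_fun setT (fun x => `|f x|%:E).
  by apply/measurable_EFinP; apply: measurableT_comp => //; exact/measurable_EFinP.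
have ag : measurable_fun setT (fun y => `|g y|%:E).
  by apply/measurable_EFinP; apply: measurableT_comp => //; exact/measurable_EFinP.
rewrite (eq_integral (fun x => `|f x|%:E * \int[m2]_y `|g y|%:E))%E; last first.
  move=> x _ /=; rewrite -ge0_integralZl//.
  by apply: eq_integral => y _; rewrite /= normrM EFinM.
rewrite ge0_integralZr//; last exact: integral_ge0.
by rewrite lte_mul_pinfty// ?integral_ge0// ge0_fin_numE// integral_ge0.
Qed.

Lemma Rintegral_prod_mul :
  \int[(m1 \x m2)%E]_z fg z = \int[m1]_x f x * \int[m2]_y g y.
Proof.
rewrite /Rintegral -(integral12_prod_meas1 integrable_prod_mul) /fubini_F /=.
rewrite (eq_integral (fun x => (f x)%:E * (\int[m2]_y (g y)%:E)))%E; last first.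
  move=> x _ /=; rewrite -integralZl//.
have fin_g := integrable_fin_num measurableT intg.
rewrite -(fineK fin_g) integralZr// fineM//.
exact: (integrable_fin_num measurableT intf).
Qed.
End product_integral.

Lemma cons_rV_head (R : realType) (d : nat) (t : R) (x : 'rV[R]_d) :
  (@cons_rV R d (t, x) : 'rV[R]_d.+1) 0 ord0 = t.
Proof.
rewrite /cons_rV; transitivity (row_mx (t%:M : 'M[R]_1) x 0 (lshift d 0)).
  by congr (row_mx _ _ _ _); exact: val_inj.
by rewrite row_mxEl mxE eqxx.
Qed.

Lemma cons_rV_tail (R : realType) (d : nat) (t : R) (x : 'rV[R]_d) c :
  (@cons_rV R d (t, x) : 'rV[R]_d.+1) 0 (lift ord0 c) = x 0 c.
Proof.
rewrite /cons_rV; transitivity (row_mx (t%:M : 'M[R]_1) x 0 (rshift 1 c)).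
  by congr (row_mx _ _ _ _); exact: val_inj.
by rewrite row_mxEr.
Qed.

(** Fubini's theorem, one coordinate at a time. *)
Lemma integrable_prod_coord (R : realType) (d : nat) (f : 'I_d -> R -> R) :
  (forall c, (@lebesgue_measure R).-integrable setT (EFin \o f c)) ->
  (lebesgue_rV R d).-integrable setT
    (fun z : borel_rV R d => (\prod_c f c ((z : 'rV[R]_d) 0 c))%:E) /\
  \int[lebesgue_rV R d]_z (\prod_c f c ((z : 'rV[R]_d) 0 c)) =
  \prod_c \int[lebesgue_measure]_t f c t.
Proof.
elim: d f => [|d IH] f intf.
  have -> : (fun z : borel_rV R 0 => \prod_c f c ((z : 'rV[R]_0) 0 c)) = cst 1.
    by apply/funext => z; rewrite big_ord0.
  have -> : (fun z : borel_rV R 0 => (\prod_c f c ((z : 'rV[R]_0) 0 c))%:E) = cst 1%:E.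
    by apply/funext => z; rewrite big_ord0.
  have l0 : lebesgue_rV R 0 setT = 1%E by exact: diracT.
  split; last by rewrite Rintegral_cst// big_ord0 mul1r; exact: (congr1 fine l0).
  apply/integrableP; split => //.
  under eq_integral do rewrite /= normr1.
  rewrite integral_cst// mul1e.
  exact: (eq_ind_r (fun x => x < +oo)%E (ltry 1) l0).
have [intg Eg] := IH (fun c => f (lift ord0 c)) (fun c => intf (lift ord0 c)).
pose g (x : borel_rV R d) := \prod_c f (lift ord0 c) ((x : 'rV[R]_d) 0 c).
pose F (z : borel_rV R d.+1) := \prod_c f c ((z : 'rV[R]_d.+1) 0 c).
have FE t x : F (cons_rV (t, x)) = f ord0 t * g x.
  rewrite /F big_ord_recl cons_rV_head; congr (_ * _).
  by apply: eq_bigr => c _; rewrite cons_rV_tail.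
have mF : measurable_fun setT (EFin \o F).
  apply/measurable_EFinP; apply: measurable_prod => c _.
  apply: (measurableT_comp _ (measurable_coord c)).
  by apply/measurable_EFinP; exact: (measurable_int _ (intf c)).
have intF := integrable_prod_mul (intf ord0) intg.
have intFc : (lebesgue_measure \x lebesgue_rV R d)%E.-integrable
    (@cons_rV R d @^-1` setT) ((EFin \o F) \o @cons_rV R d).
  have -> : (EFin \o F) \o @cons_rV R d = EFin \o (fun z => f ord0 z.1 * g z.2).
    by apply/funext => -[t x] /=; rewrite FE.
  exact: intF.
split.
  exact: (@integrable_pushforward _ _ _ _ _ _ (@measurable_cons_rV R d) _ setT (EFin \o F)).
rewrite big_ord_recl /= -Eg -Rintegral_prod_mul// /Rintegral; congr fine.
rewrite -[LHS]/(\int[pushforward (lebesgue_measure \x lebesgue_rV R d)%E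
  (@cons_rV R d)]_z (EFin \o F) z)%E.
rewrite integral_pushforward//; last exact: measurable_cons_rV.
by apply: eq_integral => -[t x] _ /=; rewrite FE.
Qed.

(** * The reference cube *)

(** Boxes are used for the closed and for the open cube: they have the same
    integrals, so that the boundary of the cube is a null set. *)
Definition box (R : realType) (d : nat) (I : set R) : set (borel_rV R d) :=
  [set z | forall c, I ((z : 'rV[R]_d) 0 c)].

Lemma boxE (R : realType) (d : nat) (I : set R) :
  @box R d I = \big[setI/setT]_(c < d)
    (fun z : borel_rV R d => (z : 'rV[R]_d) 0 c) @^-1` I.
Proof.
rewrite -bigcap_seq; apply/seteqP; split=> z zI; first by move=> c _; exact: zI.
by move=> c; apply: (zI c); rewrite /= mem_index_enum.
Qed.

Lemma measurable_box (R : realType) (d : nat) (I : set R) :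
  measurable (I : set (measurableTypeR R)) -> measurable (@box R d I).
Proof.
move=> mI; rewrite boxE; apply: bigsetI_measurable => c _.
by rewrite -[X in measurable X]setTI; exact: measurable_coord.
Qed.

Lemma integrable_horner_sub (R : realType) (I : set (measurableTypeR R)) (q : {poly R}) :
  measurable I -> I `<=` `[-1, 1]%classic ->
  (@lebesgue_measure R).-integrable I (EFin \o horner q).
Proof.
move=> mI I_sub.
exact: (@integrableS _ (measurableTypeR R) R lebesgue_measure
  (`[(-1 : R), 1]%classic : set (measurableTypeR R)) I (EFin \o horner q)
  (measurable_itv _) mI I_sub (integrable_horner _)).
Qed.

Section box_integral.
Context {R : realType} {d : nat} (I : set (measurableTypeR R)).
Hypothesis mI : measurable I.
Hypothesis I_sub : I `<=` `[-1, 1].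
Hypothesis intI : forall q : {poly R},
  \int[lebesgue_measure]_(t in I) q.[t] = polyint q.
Variable q : 'I_d -> {poly R}.

Let f (z : borel_rV R d) := \prod_c (q c).[(z : 'rV[R]_d) 0 c].

Let restrict_prod :
  (fun z : borel_rV R d => (\prod_c ((horner (q c)) \_ I) ((z : 'rV[R]_d) 0 c))%:E) =
  (EFin \o f) \_ (box I).
Proof.
apply/funext => z; rewrite !patchE; case: ifPn => [|]; rewrite ?inE ?notin_setE => zI.
  by rewrite /= /f; congr (_%:E); apply: eq_bigr => c _; rewrite patchE mem_set.
have [c nI] : exists c, ~ I ((z : 'rV[R]_d) 0 c) by apply/existsNP.
by rewrite (bigD1 c)//= patchE memNset// mul0r.
Qed.

Let int1 c : (@lebesgue_measure R).-integrable setT (EFin \o ((horner (q c)) \_ I)).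
Proof.
rewrite -restrict_EFin; apply/(integrable_mkcond _ mI).
exact: integrable_horner_sub.
Qed.

Lemma integrable_box : (lebesgue_rV R d).-integrable (box I) (EFin \o f).
Proof.
apply: (@integrable_mkcond _ (borel_rV R d) R (lebesgue_rV R d) (box I)
  (EFin \o f) _).2; first exact: measurable_box.
by rewrite -restrict_prod; have [] := integrable_prod_coord int1.
Qed.

Lemma Rintegral_box : \int[lebesgue_rV R d]_(z in box I) f z = \prod_c polyint (q c).
Proof.
have [_] := integrable_prod_coord int1; rewrite /Rintegral restrict_prod.
rewrite -integral_mkcond => ->; apply: eq_bigr => c _.
by rewrite -intI /Rintegral [in RHS]integral_mkcond restrict_EFin.
Qed.

End box_integral.

Definition open_cube (R : realType) (d : nat) : set (borel_rV R d) :=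
  box `](-1 : R), 1[%classic.

Lemma ref_cubeE (R : realType) (d : nat) :
  @ref_cube R d = @box R d `[(-1 : R), 1]%classic.
Proof. by apply/seteqP; split=> z zI c; have := zI c; rewrite /= in_itv. Qed.

Lemma polyint_oo (R : realType) (q : {poly R}) :
  \int[lebesgue_measure]_(t in `](-1 : R), 1[) q.[t] = polyint q.
Proof.
rewrite Rintegral_itv_bndo_bndc; last first.
  by apply: integrable_horner_sub => //; exact: subset_itv_oo_cc.
rewrite Rintegral_itv_obnd_cbnd//.
by apply: integrable_horner_sub => //; exact: subset_itv_oc_cc.
Qed.

Lemma measurable_open_cube (R : realType) (d : nat) : measurable (@open_cube R d).
Proof. exact: measurable_box. Qed.

Lemma measurable_ref_cube (R : realType) (d : nat) :
  measurable (@ref_cube R d : set (borel_rV R d)).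
Proof. by rewrite ref_cubeE; exact: measurable_box. Qed.

Lemma open_cube_sub (R : realType) (d : nat) : @open_cube R d `<=` @ref_cube R d.
Proof.
move=> z zI c; have := zI c; rewrite /= in_itv /= => /andP[h1 h2].
by rewrite !ltW.
Qed.

Lemma box_measure (R : realType) (d : nat) (I : set (measurableTypeR R)) :
  measurable I -> I `<=` `[(-1), 1]%classic ->
  (forall q : {poly R}, \int[lebesgue_measure]_(t in I) q.[t] = polyint q) ->
  lebesgue_rV R d (box I) = (polyint (1 : {poly R}) ^+ d)%:E.
Proof.
move=> mI I_sub intI.
have i1 := integrable_box mI I_sub (fun _ : 'I_d => 1).
have e1 := Rintegral_box mI I_sub intI (fun _ : 'I_d => 1).
have one (z : borel_rV R d) : \prod_(c < d) (1 : {poly R}).[(z : 'rV[R]_d) 0 c] = 1.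
  by rewrite big1// => c _; rewrite hornerC.
have fin : lebesgue_rV R d (box I) \is a fin_num.
  have /integrableP[_] := i1.
  rewrite (eq_integral (cst 1%E)) => [|z _]; last by rewrite /= one normr1.
  rewrite integral_cst ?mul1e; last exact: measurable_box.
  by move=> ?; rewrite ge0_fin_numE.
rewrite -(fineK fin); congr (_%:E).
rewrite -[X in _ ^+ X]card_ord -prodr_const -e1.
rewrite /Rintegral (eq_integral (cst 1%E)) => [|z _]; last by rewrite /= one.
by rewrite integral_cst ?mul1e//; exact: measurable_box.
Qed.

Lemma cube_boundary_null (R : realType) (d : nat) :
  lebesgue_rV R d (@ref_cube R d `\` @open_cube R d) = 0%E.
Proof.
have mcc : lebesgue_rV R d (@ref_cube R d) = (polyint (1 : {poly R}) ^+ d)%:E.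
  by rewrite ref_cubeE box_measure.
have moo : lebesgue_rV R d (@open_cube R d) = (polyint (1 : {poly R}) ^+ d)%:E.
  rewrite /open_cube box_measure//; first exact: subset_itv_oo_cc.
  exact: polyint_oo.
transitivity (lebesgue_rV R d (@ref_cube R d) - lebesgue_rV R d (@open_cube R d))%E.
  have {2}<- : @ref_cube R d `&` @open_cube R d = @open_cube R d.
    by rewrite setIidr//; exact: open_cube_sub.
  apply: measureD; [exact: measurable_ref_cube|exact: measurable_open_cube|].
  by apply: (eq_ind_r (fun x => x < +oo)%E _ mcc); rewrite ltry.
by rewrite mcc moo -EFinB subrr.
Qed.

Lemma integrable_affine (R : realType) (d : nat) (A : 'M[R]_d) b
    (D : set (borel_rV R d)) (f : borel_rV R d -> \bar R) :
  A \in unitmx -> measurable D -> measurable_fun D f ->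
  (lebesgue_rV R d).-integrable (affine A b @^-1` D) (f \o affine A b) ->
  (lebesgue_rV R d).-integrable D f.
Proof.
move=> uA mD mf /integrableP[_ fin]; apply/integrableP; split => //.
rewrite (ge0_integral_affine b uA)//; last by apply: measurableT_comp.
by rewrite lte_mul_pinfty// ?lee_fin ?normr_ge0.
Qed.

Lemma Rintegral_affine (R : realType) (d : nat) (A : 'M[R]_d) b
    (D : set (borel_rV R d)) (f : borel_rV R d -> R) :
  A \in unitmx -> measurable D -> measurable_fun D f ->
  (lebesgue_rV R d).-integrable (affine A b @^-1` D) (EFin \o f \o affine A b) ->
  \int[lebesgue_rV R d]_(y in D) f y =
  `|\det A| * \int[lebesgue_rV R d]_(z in affine A b @^-1` D) f (affine A b z).
Proof.
move=> uA mD mf intf; rewrite /Rintegral.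
have mDA : measurable (affine A b @^-1` D) by exact: measurable_affine_preimage.
have intp := integrable_funepos mDA intf; have intn := integrable_funeneg mDA intf.
have fp := integrable_fin_num mDA intp; have fn := integrable_fin_num mDA intn.
have mf' : measurable_fun D (EFin \o f) by exact/measurable_EFinP.
suff -> : (\int[lebesgue_rV R d]_(y in D) (f y)%:E = `|\det A|%:E *
    \int[lebesgue_rV R d]_(z in affine A b @^-1` D) (f (affine A b z))%:E)%E.
  by rewrite fineM// (integrable_fin_num mDA intf).
rewrite [LHS]integralE [X in _ = (_ * X)%E]integralE.
rewrite (ge0_integral_affine b uA)//; last exact: measurable_funepos.
rewrite [X in (_ - X)%E](ge0_integral_affine b uA)//; last exact: measurable_funeneg.
have pE : ((EFin \o f) \o affine A b)^\+%E = (EFin \o f)^\+%E \o affine A b.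
  by apply/funext => z; rewrite funepos_comp.
have nE : ((EFin \o f) \o affine A b)^\-%E = (EFin \o f)^\-%E \o affine A b.
  by apply/funext => z; rewrite funeneg_comp.
rewrite pE in fp *; rewrite nE in fn *.
by apply: esym; apply: muleBr => //; exact: fin_num_adde_defr fp.
Qed.

(** * Geometry of the mesh *)

Lemma continuous_linear_coord (R : realType) (d : nat) (v : 'cV[R]_d) (c : R) :
  continuous (fun y : 'rV[R]_d => (y *m v) 0 0 + c).
Proof.
have -> : (fun y : 'rV[R]_d => (y *m v) 0 0 + c) = (fun y => \sum_j y 0 j * v j 0 + c).
  by apply/funext => z; rewrite mxE.
move=> y.
have cS : (\sum_j (x : 'rV[R]_d) 0 j * v j 0) @[x --> y] --> \sum_j y 0 j * v j 0.
  apply: (@cvg_big R 'I_d +%R 0 xpredT (@add_continuous R^o) _ (nbhs y)) => j _.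
  by apply: cvgMl; exact: coord_continuous.
exact: (cvgD cS (cvg_cst c)).
Qed.

(** The bound [s < 1] keeps the point on the segment from [y] to [y + u]. *)
Lemma nbhs_ray (R : realType) (d : nat) (y u : 'rV[R]_d) (O : set 'rV[R]_d) :
  nbhs y O -> exists s : R, [/\ 0 < s, s < 1 & O (y + s *: u)].
Proof.
move=> yO.
have h : (fun s : R => y + s *: u) @ 0^'+ --> y + 0 *: u.
  apply: cvgD; first exact: cvg_cst.
  by apply: cvgZr_tmp; apply: cvg_at_right_filter; exact: cvg_id.
rewrite scale0r addr0 in h.
have : \forall s \near 0^'+, [/\ 0 < s, s < 1 & O (y + s *: u)].
  near=> s; split.
  - by near: s; exact: nbhs_right_gt.
  - by near: s; exact: nbhs_right_lt.
  - by near: s; exact: (h O yO).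
by move=> /filter_ex.
Unshelve. all: by end_near. Qed.

Lemma open_box (R : realType) (d : nat) (B : 'M[R]_d) (c : 'rV[R]_d) (I : set R) :
  open I -> open ((fun y : 'rV[R]_d => y *m B + c) @^-1` @box R d I).
Proof.
move=> oI; rewrite openE => y yI.
suff : \forall z \near y, forall k, I (((z : 'rV[R]_d) *m B + c) 0 k) by [].
apply: (@filter_forall _ _ (fun k => [set z : 'rV[R]_d | I ((z *m B + c) 0 k)])
  (nbhs y) (nbhs_filter y)) => k.
have := @continuous_linear_coord R d (col k B) (c 0 k) y.
have E (z : 'rV[R]_d) : (z *m B + c) 0 k = (z *m col k B) 0 0 + c 0 k.
  by rewrite !mxE; congr (_ + _); apply: eq_bigr => j _; rewrite !mxE.
move=> /(_ I); rewrite -E => /(_ (open_nbhs_nbhs (conj oI (yI k)))).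
move=> h; apply: (@filterS _ (nbhs y) (nbhs_filter y) _ _ _ h) => z /=.
by rewrite -E.
Qed.

(** A Lipschitz domain lies locally on one side of its boundary: just beyond a
    boundary point, in the direction [nu], there is a ball that avoids it. *)
Lemma lipschitz_interior_closure (R : realType) (d : nat) (Omega : set 'rV[R]_d) :
  open Omega -> lipschitz_boundary Omega -> interior (closure Omega) `<=` Omega.
Proof.
move=> oO lip x xO; apply: contrapT => nOx.
have [|U [nu [g [xU nu1 lg Ug]]]] := lip x.
  split; first exact: interior_subset xO.
  by move=> /interior_subset.
pose P y := y - dotv y nu *: nu.
have dotE y : dotv y nu = (y *m nu^T) 0 0 + 0 by rewrite addr0.
have cdot : continuous (fun y : 'rV[R]_d => dotv y nu).
  by rewrite (_ : (fun y => _) = fun y => (y *m nu^T) 0 0 + 0);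
    [exact: continuous_linear_coord|apply/funext => y; exact: dotE].
have cg : continuous g.
  move: lg => /pinfty_ex_gt0[M M0 lM] y.
  apply/(@cvgrPdist_lt _ R^o _ (nbhs y) (nbhs_filter y)) => e e0.
  have near_y : nbhs y [set z | `|y - z| < e / M].
    have := nbhsx_ballx y (e / M) (divr_gt0 e0 M0); by rewrite -ball_normE.
  apply: (@filterS _ (nbhs y) (nbhs_filter y) _ _ _ near_y) => z /=.
  rewrite ltr_pdivlMr// mulrC; apply: le_lt_trans.
  exact: (lM (y, z)).
have cP : continuous P.
  move=> y; apply: (@cvgB _ _ _ (nbhs y) (nbhs_filter y)); first exact: cvg_id.
  by apply: (@cvgZr_tmp _ _ _ (nbhs y) (nbhs_filter y)); exact: cdot.
pose h y := dotv y nu - g (P y).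
have ch : continuous h.
  move=> y; apply: (@cvgB _ R^o _ (nbhs y) (nbhs_filter y)); first exact: cdot.
  by apply: continuous_comp; [exact: cP|exact: cg].
have hx : 0 <= h x.
  rewrite subr_ge0 leNgt; apply/negP => hlt; apply: nOx.
  by apply/Ug; first exact: nbhs_singleton.
(* Moving along [nu] leaves [P] fixed, so that [h] grows at unit speed. *)
have hs s : h (x + s *: nu) = h x + s.
  have dE : dotv (x + s *: nu) nu = dotv x nu + s.
    rewrite /dotv mulmxDl -scalemxAl !mxE /=.
    by move: nu1; rewrite /dotv mxE => ->; rewrite mulr1.
  rewrite /h dE addrAC; congr (_ - g _ + _); rewrite /P dE scalerDl opprD addrACA.
  by rewrite subrr addr0.
have [s [s0 _ [xs Us]]] : exists s : R, [/\ 0 < s, s < 1 &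
    ((closure Omega)^° `&` U^°) (x + s *: nu)].
  apply: nbhs_ray; apply: filterI.
    by apply: open_nbhs_nbhs; split => //; exact: open_interior.
  by apply: open_nbhs_nbhs; split; [exact: open_interior|].
have : nbhs (x + s *: nu) (U `&` [set y | 0 < h y]).
  apply: filterI => //.
  have : 0 < h (x + s *: nu) by rewrite hs ltr_wpDl.
  move=> h0; apply: (ch (x + s *: nu) [set t | 0 < t]).
  by apply: open_nbhs_nbhs; split => //; exact: open_gt.
move: xs => /interior_subset/[apply] -[y [Oy [Uy]]] /=.
by rewrite subr_gt0 ltNge => /negP[]; apply/ltW/Ug.
Qed.

Definition inv_affine (R : realType) (d : nat) (A : 'M[R]_d) (b : 'rV[R]_d) :=
  affine (invmx A) (- (b *m invmx A)).

Lemma affineK (R : realType) (d : nat) (A : 'M[R]_d) (b : 'rV[R]_d) :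
  A \in unitmx -> cancel (affine A b) (inv_affine A b).
Proof. by move=> uA z; rewrite /inv_affine /affine mulmxDl mulmxK// addrK. Qed.

Lemma inv_affineK (R : realType) (d : nat) (A : 'M[R]_d) (b : 'rV[R]_d) :
  A \in unitmx -> cancel (inv_affine A b) (affine A b).
Proof.
by move=> uA z; rewrite /inv_affine /affine mulmxDl mulNmx !mulmxKV// subrK.
Qed.

(** A small multiple of a vector of the kernel lies in the cube, and would have the
    same image as the centre 0. *)
Lemma affine_unitmx (R : realType) (d : nat) (A : 'M[R]_d) (b : 'rV[R]_d) :
  set_inj (@ref_cube R d) (affine A b) -> A \in unitmx.
Proof.
move=> injA; rewrite -row_free_unit -kermx_eq0; apply/rowV0P => v /sub_kermxP vA.
pose M := 1 + \sum_j `|v 0 j|.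
have M0 : 0 < M by rewrite ltr_pwDl ?ltr01// sumr_ge0.
have : M^-1 *: v = 0.
  apply: injA; rewrite ?inE.
  - move=> c; rewrite mxE -ler_norml normrM normfV (gtr0_norm M0) mulrC.
    rewrite ler_pdivrMr// mul1r /M (bigD1 c)//= addrCA lerDl addr_ge0// sumr_ge0//.
  - by move=> c; rewrite mxE lerN10 ler01.
  - by rewrite /affine -scalemxAl vA scaler0 mul0mx.
by move=> /eqP; rewrite scaler_eq0 invr_eq0 (gt_eqF M0) => /eqP.
Qed.

Section mesh.
Context {R : realType} {d N : nat} (Omega : set 'rV[R]_d).
Variables (F : 'I_N -> 'rV[R]_d -> 'rV[R]_d).
Variables (A : 'I_N -> 'M[R]_d) (b : 'I_N -> 'rV[R]_d).
Hypothesis FE : forall e, F e = affine (A e) (b e).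
Hypothesis mesh : conforming_mesh Omega F.

Lemma elt_unitmx e : A e \in unitmx.
Proof. by have [injF _ _ _] := mesh; have := injF e; rewrite FE => /affine_unitmx. Qed.
Hint Resolve elt_unitmx : core.

(** The image of the open cube. It is contained in the interior of the element, and
    unlike the latter it is described by coordinates. *)
Definition elt_interior e : set (borel_rV R d) :=
  inv_affine (A e) (b e) @^-1` @open_cube R d.

Lemma elementE e : element (F e) = inv_affine (A e) (b e) @^-1` @ref_cube R d.
Proof.
rewrite /element FE; apply/seteqP; split=> [_ [z zC <-]|y yC] /=.
  by rewrite affineK.
by exists (inv_affine (A e) (b e) y) => //; rewrite inv_affineK.
Qed.

Lemma pinv_element e y : element (F e) y ->
  pinv (@ref_cube R d) (F e) y = inv_affine (A e) (b e) y.
Proof.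
move=> [z zC <-]; have [injF _ _ _] := mesh.
rewrite [X in inv_affine _ _ (X _)]FE affineK//.
by apply: pinvKV; [exact: injF|rewrite inE].
Qed.

Lemma measurable_element e : measurable (element (F e) : set (borel_rV R d)).
Proof.
by rewrite elementE; apply: measurable_affine_preimage; exact: measurable_ref_cube.
Qed.

Lemma measurable_elt_interior e : measurable (elt_interior e).
Proof. by apply: measurable_affine_preimage; exact: measurable_open_cube. Qed.

Lemma elt_interior_sub e : elt_interior e `<=` element (F e).
Proof. by rewrite elementE => y; exact: open_cube_sub. Qed.

Lemma open_elt_interior e : open (elt_interior e : set 'rV[R]_d).
Proof. by apply: open_box; exact: interval_open. Qed.

Lemma elt_interior_interior e : elt_interior e `<=` interior (element (F e)).
Proof.
move=> y ye.
apply: (@filterS _ (nbhs y) (nbhs_filter y) _ _ (@elt_interior_sub e)).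
by apply: open_nbhs_nbhs; split; [exact: open_elt_interior|].
Qed.

Lemma elt_boundary_null e :
  lebesgue_rV R d (element (F e) `\` elt_interior e) = 0%E.
Proof.
have uA : invmx (A e) \in unitmx by rewrite unitmx_inv.
have mC : measurable (@ref_cube R d `\` @open_cube R d : set (borel_rV R d)).
  by apply: measurableD; [exact: measurable_ref_cube|exact: measurable_open_cube].
have := scales_volume_det (- (b e *m invmx (A e))) uA mC.
rewrite cube_boundary_null => /eqP; rewrite mule_eq0 eqe normr_eq0.
rewrite -[_ == 0]negbK -unitfE -unitmxE uA /= => /eqP h.
by rewrite elementE -[RHS]h.
Qed.

Hypothesis oO : open Omega.
Hypothesis lip : lipschitz_boundary Omega.

Lemma elt_interior_Omega e : elt_interior e `<=` Omega.
Proof.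
move=> y ye; apply: (lipschitz_interior_closure oO lip).
have [_ -> _ _] := mesh.
apply: (@filterS _ (nbhs y) (nbhs_filter y) (elt_interior e)).
  by move=> z /elt_interior_sub ze; exists e.
by apply: open_nbhs_nbhs; split; [exact: open_elt_interior|].
Qed.

(** A point of an element is the limit of points of its interior, along the
    segment to the centre. *)
Lemma elt_interior_disjoint e e' y : e != e' -> elt_interior e y ->
  ~ element (F e') y.
Proof.
move=> ee' ye [z zC Fz].
have : nbhs y (elt_interior e) by apply: open_nbhs_nbhs; split; [exact: open_elt_interior|].
move=> /(nbhs_ray (- (z *m A e')))[s [s0 s1]] ys.
have [_ _ /(_ e e' ee') dis _] := mesh.
suff : (interior (element (F e)) `&` interior (element (F e'))) (y + s *: - (z *m A e')).
  by rewrite dis.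
split; first exact: elt_interior_interior.
apply: elt_interior_interior; rewrite /elt_interior /=.
have -> : y + s *: - (z *m A e') = affine (A e') (b e') ((1 - s) *: z).
  rewrite -Fz FE /affine scalerN -scalemxAl scalerBl scale1r.
  by rewrite addrAC.
rewrite affineK// => c /=; rewrite in_itv /= mxE -ltr_norml normrM ger0_norm ?subr_ge0 ?(ltW s1)//.
have z1 : `|z 0 c| <= 1 by rewrite ler_norml.
rewrite (le_lt_trans (y := 1 - s))//; first by rewrite ler_piMr// subr_ge0 ltW.
by rewrite gtrBl.
Qed.

End mesh.

Lemma continuous_mulmxr (R : realType) (d : nat) (A : 'M[R]_d) :
  continuous (mulmxr A : 'rV[R]_d -> 'rV[R]_d).
Proof.
move=> y V [P nP sP]; rewrite /= in nP *.
have h : nbhs y [set z : 'rV[R]_d | forall j, P 0 j ((z *m A) 0 j)].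
  apply: (@filter_forall _ _ (fun j => [set z : 'rV[R]_d | P 0 j ((z *m A) 0 j)])
    (nbhs y) (nbhs_filter y)) => j.
  have E (z : 'rV[R]_d) : (z *m A) 0 j = (z *m col j A) 0 0 + 0.
    by rewrite addr0 !mxE; apply: eq_bigr => k _; rewrite !mxE.
  have := @continuous_linear_coord R d (col j A) 0 y (P 0 j); rewrite -E => /(_ (nP 0 j)) h.
  apply: (@filterS _ (nbhs y) (nbhs_filter y) _ _ _ h) => z /=.
  by rewrite E.
apply: (@filterS _ (nbhs y) (nbhs_filter y) _ _ _ h) => z /= zP; apply: sP => i j.
by rewrite (ord1 i); exact: zP.
Qed.

Lemma jacobian_affine (R : realType) (d : nat) (A : 'M[R]_d) (b p : 'rV[R]_d) :
  jacobian (affine A b : 'rV[R]_d -> 'rV[R]_d) p = A.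
Proof.
have cA := @continuous_mulmxr R d A.
pose L : {linear 'rV[R]_d -> 'rV[R]_d} := mulmxr A.
have dE : 'd ((L : 'rV[R]_d -> 'rV[R]_d) + cst b) p =
    L \+ (0 : 'rV[R]_d -> 'rV[R]_d) :> ('rV[R]_d -> 'rV[R]_d).
  rewrite (diffD (linear_differentiable p cA) (differentiable_cst b p)).
  have h1 := diff_lin (f := L) p cA; have h2 := diff_cst b p.
  by apply/funext => z; exact: (f_equal2 +%R (congr1 (@^~ z) h1) (congr1 (@^~ z) h2)).
apply/matrixP => i j; rewrite /jacobian mxE.
rewrite -[affine A b]/((L : 'rV[R]_d -> 'rV[R]_d) + cst b) dE /= /L /=.
by rewrite addr0 -rowE mxE.
Qed.

(** * Integration over a partition up to a null set *)

Section ae_partition.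
Context d0 (T : measurableType d0) (R : realType) (mu : {measure set T -> \bar R}).

Lemma Rintegral_sum (D : set T) (I : Type) (s : seq I) (P : pred I) (f : I -> T -> R) :
  measurable D -> (forall i, mu.-integrable D (EFin \o f i)) ->
  mu.-integrable D (EFin \o (fun x => \sum_(i <- s | P i) f i x)) /\
  \int[mu]_(x in D) (\sum_(i <- s | P i) f i x) =
  \sum_(i <- s | P i) \int[mu]_(x in D) f i x.
Proof.
move=> mD intf.
have intS : mu.-integrable D (EFin \o (fun x => \sum_(i <- s | P i) f i x)).
  rewrite (_ : EFin \o _ = fun x => (\sum_(i <- s | P i) (f i x)%:E)%E).
    by apply: (integrable_sum mD) => i _; exact: intf.
  by apply/funext => x; rewrite sumEFin.
split => //; rewrite /Rintegral.
under eq_integral do rewrite -sumEFin.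
rewrite (integral_sum mD)// sum_fine// => i _.
exact: (integrable_fin_num mD (intf i)).
Qed.

(** The hypothesis on [D] says that the [G e] fill it up to the null set [Z];
    integrability on [D] follows from integrability on the pieces. *)
Lemma Rintegral_ae_partition (N : nat) (D Z : set T) (G : 'I_N -> set T) (f : T -> R) :
  measurable D -> measurable Z -> mu Z = 0%E ->
  (forall e, measurable (G e)) -> trivIset setT G ->
  D `\` Z = \big[setU/set0]_(e < N) G e ->
  measurable_fun D f ->
  (forall e, mu.-integrable (G e) (EFin \o f)) ->
  \int[mu]_(x in D) f x = \sum_e \int[mu]_(x in G e) f x.
Proof.
move=> mD mZ Z0 mG tG DZ mf intf.
have mf' : measurable_fun D (EFin \o f) by exact/measurable_EFinP.
have mDZ : measurable (D `\` Z) by exact: measurableD.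
have mU : measurable_fun (D `\` Z) (EFin \o f).
  by apply: measurable_funS mf' => // x [].
have intU : mu.-integrable (D `\` Z) (EFin \o f).
  apply/integrableP; split => //; rewrite DZ ge0_integral_bigsetU//.
  - apply/lte_sum_pinfty => e _.
    by have /integrableP[] := intf e.
  - exact: index_enum_uniq.
  - by apply: sub_trivIset tG.
  - by rewrite -DZ; apply: measurableT_comp.
have intD : mu.-integrable D (EFin \o f).
  by apply/(negligible_integrable mZ mD mf' Z0).
rewrite /Rintegral (negligible_integral mZ mD intD Z0) DZ.
rewrite integral_bigsetU_EFin//; last 3 first.
- exact: index_enum_uniq.
- by apply: sub_trivIset tG.
- by rewrite -DZ.
by rewrite sum_fine// => e _; exact: (integrable_fin_num (mG e) (intf e)).
Qed.
End ae_partition.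

(** * Assembly of the mass matrices *)

Lemma tensor_lagrangeE (R : realType) (d p : nat) (xi : 'I_p.+1 -> R)
    (k : multi_index d p) (z : 'rV[R]_d) :
  tensor_lagrange xi k z = \prod_c (lagrange_poly xi (k c)).[z 0 c].
Proof. by apply: eq_bigr => c _; rewrite horner_lagrange_poly. Qed.

Lemma measurable_tensor_lagrange (R : realType) (d p : nat) (xi : 'I_p.+1 -> R)
    (k : multi_index d p) :
  measurable_fun setT (tensor_lagrange xi k : borel_rV R d -> R).
Proof.
apply: (eq_measurable_fun (fun z : borel_rV R d =>
    \prod_c (lagrange_poly xi (k c)).[(z : 'rV[R]_d) 0 c])).
  by move=> z _; rewrite tensor_lagrangeE.
apply: measurable_prod => c _; apply: (measurableT_comp _ (measurable_coord c)).
by apply: continuous_measurable_fun => t; exact: continuous_horner.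
Qed.

(** [pick] returns the first solution in the enumeration, so that the function is a
    cascade of conditionals on measurable sets. *)
Lemma measurable_pick (R : realType) d0 (T : measurableType d0) (I : finType)
    (E : I -> set T) (g : I -> T -> R) :
  (forall e, measurable (E e)) -> (forall e, measurable_fun setT (g e)) ->
  measurable_fun setT (fun y => if [pick e | y \in E e] is Some e then g e y else 0).
Proof.
move=> mE mg; rewrite /pick /enum_mem.
elim: (Finite.enum I) => [|e s IH] //=.
rewrite (_ : (fun y => _) = fun y => if y \in E e then g e y else
    if ohead [seq x <- s | y \in E x] is Some e then g e y else 0).
  apply: measurable_fun_ifT => //; apply: (@measurable_fun_bool _ _ _ _ true).
  rewrite setTI (_ : _ @^-1` _ = E e)//.
  by apply/seteqP; split=> y /=; [exact: set_mem|exact: mem_set].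
apply/funext => y; have -> : (e \in (fun x => y \in E x)) = (y \in E e) by [].
by case: (y \in E e).
Qed.

Section mass.
Context {R : realType} {d p N n : nat} (Omega : set 'rV[R]_d).
Variables (F : 'I_N -> 'rV[R]_d -> 'rV[R]_d).
Variables (A : 'I_N -> 'M[R]_d) (b : 'I_N -> 'rV[R]_d).
Hypothesis FE : forall e, F e = affine (A e) (b e).
Hypothesis mesh : conforming_mesh Omega F.
Hypothesis oO : open Omega.
Hypothesis lip : lipschitz_boundary Omega.
Variables (xi : 'I_p.+1 -> R) (X : 'I_n -> 'rV[R]_d).
Variables (rho : 'rV[R]_d -> R) (r : 'I_N -> R).
Hypothesis mrho : measurable_fun (Omega : set (borel_rV R d)) rho.
Hypothesis rho_const : forall e y, interior (element (F e)) y -> rho y = r e.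

(** The polynomial on the whole space that extends a local basis function; unlike
    the latter, it is visibly measurable. *)
Definition elt_poly e (k : multi_index d p) (y : borel_rV R d) : R :=
  tensor_lagrange xi k (inv_affine (A e) (b e) y).

Lemma measurable_elt_poly e k : measurable_fun setT (elt_poly e k).
Proof.
apply: (measurableT_comp (measurable_tensor_lagrange xi k)).
exact: measurable_affine.
Qed.

Lemma elt_basisE e k y : element (F e) y -> elt_basis F xi e k y = elt_poly e k y.
Proof. by move=> ye; rewrite /elt_basis (pinv_element FE mesh ye). Qed.

Lemma measurable_glob_basis i :
  measurable_fun [set: borel_rV R d] (glob_basis F xi X i : borel_rV R d -> R).
Proof.
apply: (eq_measurable_fun (fun y : borel_rV R d =>
  if [pick e | y \in (element (F e) : set (borel_rV R d))] is Some e
  then \sum_(k | elt_node F xi e k == X i) elt_poly e k y else 0)).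
  move=> y _; rewrite /glob_basis; case: pickP => // e /set_mem ye.
  by apply: eq_bigr => k _; rewrite elt_basisE.
apply: measurable_pick => e; first exact: (measurable_element FE mesh).
rewrite (_ : (fun y => _) = fun y => \sum_k
  if elt_node F xi e k == X i then elt_poly e k y else 0); last first.
  by apply/funext => y; rewrite big_mkcond.
apply: measurable_sum => k; case: (elt_node F xi e k == X i) => //.
exact: measurable_elt_poly.
Qed.

(** At an interior point of an element no other element can be picked. *)
Lemma glob_basis_interior i e y : elt_interior A b e y ->
  glob_basis F xi X i y = \sum_(k | elt_node F xi e k == X i) elt_poly e k y.
Proof.
move=> ye; rewrite /glob_basis; case: pickP => [e'|/(_ e)]; last first.
  by move=> /negbT/negP[]; apply: mem_set; exact: (elt_interior_sub FE mesh ye).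
move=> /set_mem ye'.
have <- : e = e'.
  apply/eqP; apply: contraT => ee'.
  by have := elt_interior_disjoint FE mesh ee' ye ye'.
by apply: eq_bigr => k _; rewrite elt_basisE//; exact: (elt_interior_sub FE mesh ye).
Qed.

(** An affine change of variables to the open reference cube, where the integrand
    is a product of functions of one coordinate. *)
Lemma elt_product e (k l : multi_index d p) :
  (lebesgue_rV R d).-integrable (elt_interior A b e)
    (EFin \o (fun y => elt_poly e k y * elt_poly e l y)) /\
  \int[lebesgue_rV R d]_(y in elt_interior A b e) (elt_poly e k y * elt_poly e l y) =
  `|\det (A e)| * \prod_c lagrange_gram xi (k c) (l c).
Proof.
have uA := elt_unitmx FE mesh e.
have mG := @measurable_elt_interior R d N A b e.
have mf : measurable_fun (elt_interior A b e) (fun y => elt_poly e k y * elt_poly e l y).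
  by apply: measurable_funTS; apply: measurable_funM; exact: measurable_elt_poly.
have GE : affine (A e) (b e) @^-1` elt_interior A b e = @open_cube R d.
  by apply/seteqP; split=> z /=; rewrite /elt_interior /= affineK.
have fE (z : borel_rV R d) : elt_poly e k (affine (A e) (b e) z) *
    elt_poly e l (affine (A e) (b e) z) =
    \prod_c (lagrange_poly xi (k c) * lagrange_poly xi (l c)).[(z : 'rV[R]_d) 0 c].
  rewrite /elt_poly affineK// !tensor_lagrangeE -big_split; apply: eq_bigr => c _.
  by rewrite hornerM.
have sub : `](-1 : R), 1[%classic `<=` `[(-1), 1]%classic by exact: subset_itv_oo_cc.
have mI : measurable (`](-1 : R), 1[%classic : set (measurableTypeR R)) by [].
pose q c := lagrange_poly xi (k c) * lagrange_poly xi (l c).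
have intq := integrable_box mI sub q.
have Iq := Rintegral_box mI sub (@polyint_oo R) q.
have intf : (lebesgue_rV R d).-integrable (affine (A e) (b e) @^-1` elt_interior A b e)
    ((EFin \o (fun y => elt_poly e k y * elt_poly e l y)) \o affine (A e) (b e)).
  rewrite GE (_ : _ \o _ = EFin \o (fun z : borel_rV R d => \prod_c (q c).[(z : 'rV[R]_d) 0 c]))//.
  by apply/funext => z /=; rewrite fE.
split.
  by apply: (integrable_affine uA mG _ intf); exact/measurable_EFinP.
rewrite (Rintegral_affine uA mG mf intf) GE; congr (_ * _).
under eq_Rintegral do rewrite fE.
by rewrite Iq; apply: eq_bigr => c _; rewrite mxE.
Qed.

(** Both mass matrices have this form: see [consistent_massE] and [lumped_massE]. *)
Definition assembled_mass (E : 'M[R]_p.+1) : 'M[R]_n :=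
  assemble F xi X (fun e k l => r e * `|\det (A e)| * \prod_c E (k c) (l c)).

Lemma consistent_massE :
  consistent_mass F xi X Omega rho = assembled_mass (lagrange_gram xi).
Proof.
apply/matrixP => i j; rewrite !mxE.
(* [Z] is the union of the element boundaries. *)
pose Z := \big[setU/set0]_(e < N) (element (F e) `\` elt_interior A b e : set (borel_rV R d)).
have mG e := @measurable_elt_interior R d N A b e.
have mB e : measurable (element (F e) `\` elt_interior A b e : set (borel_rV R d)).
  by apply: measurableD => //; exact: (measurable_element FE mesh).
have mZ : measurable Z by exact: bigsetU_measurable.
have Z0 : lebesgue_rV R d Z = 0%E.
  apply/negligibleP => //; rewrite /Z; elim/big_ind : _ => [|S1 S2|e _].
  - exact: negligible_set0.
  - exact: negligibleU.
  - by apply/negligibleP => //; exact: (elt_boundary_null FE mesh).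
have mO : measurable (Omega : set (borel_rV R d)) by exact: sub_sigma_algebra.
have mf : measurable_fun (Omega : set (borel_rV R d))
    (fun y => rho y * glob_basis F xi X i y * glob_basis F xi X j y).
  have mg i' : measurable_fun (Omega : set (borel_rV R d))
      (glob_basis F xi X i' : borel_rV R d -> R).
    by apply: measurable_funTS; exact: measurable_glob_basis.
  by apply: measurable_funM; [apply: measurable_funM; [exact: mrho|exact: mg]|exact: mg].
have fG e (y : borel_rV R d) : elt_interior A b e y ->
    rho y * glob_basis F xi X i y * glob_basis F xi X j y =
    \sum_(k | elt_node F xi e k == X i) \sum_(l | elt_node F xi e l == X j)
      r e * (elt_poly e k y * elt_poly e l y).
  move=> ye; rewrite !(glob_basis_interior _ ye).
  rewrite (rho_const (elt_interior_interior FE mesh ye)) -mulrA mulr_suml mulr_sumr.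
  apply: eq_bigr => k _; rewrite mulr_sumr mulr_sumr.
  by apply: eq_bigr => l _.
have intP e k l : (lebesgue_rV R d).-integrable (elt_interior A b e)
    (EFin \o (fun y => r e * (elt_poly e k y * elt_poly e l y))).
  have [intkl _] := elt_product e k l.
  rewrite (_ : EFin \o _ = fun y => ((r e)%:E *
    (EFin \o (fun z => (elt_poly e k z * elt_poly e l z)%R)) y)%E) //.
  exact: integrableZl.
have intP1 e k := Rintegral_sum (index_enum _)
  (fun l => elt_node F xi e l == X j) (mG e) (intP e k).
have intP2 e := Rintegral_sum (index_enum _)
  (fun k => elt_node F xi e k == X i) (mG e) (fun k => (intP1 e k).1).
rewrite (Rintegral_ae_partition mO mZ Z0 mG)//.
- apply: eq_bigr => e _.
  transitivity (\int[lebesgue_rV R d]_(y in elt_interior A b e)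
    (\sum_(k | elt_node F xi e k == X i) \sum_(l | elt_node F xi e l == X j)
      r e * (elt_poly e k y * elt_poly e l y))).
    by apply: eq_Rintegral => y; rewrite inE => /fG.
  rewrite (intP2 e).2; apply: eq_bigr => k _.
  rewrite (intP1 e k).2; apply: eq_bigr => l _.
  have [intkl Ekl] := elt_product e k l.
  by rewrite RintegralZl// Ekl mulrA.
- apply/trivIsetP => e e' _ _ ee'; apply/seteqP; split => // y [ye ye'].
  exact: (elt_interior_disjoint FE mesh ee' ye (elt_interior_sub FE mesh ye')).
- apply/seteqP; split=> y.
    move=> [Oy nZ]; rewrite -bigcup_seq; have [_ cO _ _] := mesh.
    have : closure Omega y by exact: subset_closure.
    rewrite cO => -[e _ ye]; exists e; first by rewrite /= mem_index_enum.
    apply: contrapT => nye; apply: nZ; rewrite /Z -bigcup_seq.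
    by exists e; rewrite //= mem_index_enum.
  rewrite -bigcup_seq => -[e _ ye]; split; first exact: (elt_interior_Omega FE mesh oO lip ye).
  rewrite /Z -bigcup_seq => -[e' _ [ye' nye']].
  have [ee'|ee'] := eqVneq e e'; first by apply: nye'; rewrite -ee'.
  exact: (elt_interior_disjoint FE mesh ee' ye ye').
- move=> e; apply: (@eq_integrable _ _ _ _ _ (mG e) _ _ _ (intP2 e).1) => y /set_mem ye /=.
  by rewrite (fG e).
Qed.
End mass.

Lemma qformE (R : realType) (n : nat) (M : 'M[R]_n) v :
  qform M v = \sum_i \sum_j v 0 i * v 0 j * M i j.
Proof.
rewrite /qform mxE; under eq_bigr do rewrite mxE mulr_suml.
rewrite exchange_big; apply: eq_bigr => i _; apply: eq_bigr => j _.
by rewrite [v^T j 0]mxE; ring.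
Qed.

Lemma nodes_inj (R : realType) (p : nat) (xi : 'I_p.+1 -> R) :
  {homo xi : a b / (a < b)%N >-> a < b} -> injective xi.
Proof.
move=> hxi a c; apply: contra_eq => ac; have [h|h|h] := ltngtP a c.
- by rewrite lt_eqF// hxi.
- by rewrite gt_eqF// hxi.
- by move/eqP: ac => []; exact: val_inj.
Qed.

Lemma nodes_bound (R : realType) (p : nat) (xi w : 'I_p.+1 -> R) a :
  gauss_lobatto xi w -> -1 <= xi a <= 1.
Proof.
move=> [hxi x0 x1 _ _]; apply/andP; split.
  have [->|a0] := eqVneq a ord0; first by rewrite x0.
  by rewrite -x0 ltW// hxi// lt0n.
have [->|am] := eqVneq a ord_max; first by rewrite x1.
by rewrite -x1 ltW// hxi// ltn_neqAle am -ltnS ltn_ord.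
Qed.

Section assembly.
Context {R : realType} {d p N n : nat} (Omega : set 'rV[R]_d).
Variables (F : 'I_N -> 'rV[R]_d -> 'rV[R]_d).
Variables (A : 'I_N -> 'M[R]_d) (b : 'I_N -> 'rV[R]_d).
Hypothesis FE : forall e, F e = affine (A e) (b e).
Hypothesis mesh : conforming_mesh Omega F.
Variables (xi w : 'I_p.+1 -> R) (X : 'I_n -> 'rV[R]_d) (r : 'I_N -> R).
Hypothesis GL : gauss_lobatto xi w.

(** Quadrature at the interpolation nodes makes the element matrix diagonal. *)
Lemma elt_basis_node e (k q : multi_index d p) :
  elt_basis F xi e k (elt_node F xi e q) = (k == q)%:R.
Proof.
have qC : @ref_cube R d (tensor_node xi q).
  by move=> c; rewrite mxE; exact: nodes_bound GL.
rewrite /elt_node (elt_basisE FE mesh); last by exists (tensor_node xi q).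
rewrite /elt_poly FE affineK ?(elt_unitmx FE mesh)//.
have [hxi _ _ _ _] := GL; rewrite tensor_lagrangeE.
under eq_bigr do rewrite mxE (lagrange_node (nodes_inj hxi)).
have [->|kq] := eqVneq k q; first by rewrite big1// => c _; rewrite eqxx.
have [c kqc] := ffun_neq kq.
by rewrite (bigD1 c)//= (negbTE kqc) mul0r.
Qed.

Lemma lumped_massE :
  lumped_mass F xi X w r = assembled_mass F A xi X r (diag_mx (\row_a w a)).
Proof.
apply/matrixP => i j; rewrite !mxE; apply: eq_bigr => e _.
apply: eq_bigr => k _; apply: eq_bigr => l _.
rewrite (eq_bigr (fun q => elt_weight F xi w r e q * (k == q)%:R * (l == q)%:R)).
  rewrite (bigD1 k)//= big1 ?addr0 => [|q qk]; last first.
    by rewrite eq_sym (negbTE qk) mulr0 mul0r.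
  rewrite eqxx mulr1.
  rewrite /elt_weight FE jacobian_affine; have [->|lk] := eqVneq l k.
    rewrite mulr1 /tensor_weight -mulrA [LHS]mulrC; congr (_ * _).
    by apply: eq_bigr => c _; rewrite !mxE eqxx.
  have [c kqc] : exists c, k c != l c by apply: ffun_neq; rewrite eq_sym.
  by rewrite mulr0 (bigD1 c)//= mxE (negbTE kqc) mulr0n mul0r mulr0.
by move=> q _; rewrite !elt_basis_node.
Qed.

Lemma assembled_mass_sym (E : 'M[R]_p.+1) :
  E^T = E -> (assembled_mass F A xi X r E)^T = assembled_mass F A xi X r E.
Proof.
move=> sE; apply/matrixP => i j; rewrite !mxE; apply: eq_bigr => e _.
rewrite exchange_big; apply: eq_bigr => k _; apply: eq_bigr => l _ /=.
by congr (_ * _); apply: eq_bigr => c _; rewrite -[in LHS]sE mxE.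
Qed.

(** The local coordinates on the element [e] of the function with global
    coordinates [v]; they vanish at Dirichlet nodes. *)
Definition elt_coef (v : 'rV[R]_n) e (k : multi_index d p) : R :=
  \sum_(i | elt_node F xi e k == X i) v 0 i.

(** Assembly is a congruence by the matrix that maps [v] to its local coordinates. *)
Lemma qform_assembled_mass (E : 'M[R]_p.+1) v :
  qform (assembled_mass F A xi X r E) v =
  \sum_e r e * `|\det (A e)| * tensor_form (fun=> E) (elt_coef v e).
Proof.
pose D e (k : multi_index d p) i : R := (elt_node F xi e k == X i)%:R.
pose t i j e k l := v 0 i * D e k i * (v 0 j * D e l j) *
  (r e * `|\det (A e)| * \prod_c E (k c) (l c)).
have coefE e k : elt_coef v e k = \sum_i v 0 i * D e k i.
  rewrite /elt_coef big_mkcond; apply: eq_bigr => i _ /=.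
  by rewrite /D; case: ifP; rewrite ?mulr1 ?mulr0.
have massE i j : v 0 i * v 0 j * assembled_mass F A xi X r E i j =
    \sum_e \sum_k \sum_l t i j e k l.
  rewrite mxE mulr_sumr; apply: eq_bigr => e _.
  rewrite big_mkcond mulr_sumr; apply: eq_bigr => k _ /=.
  rewrite /t /D; case: ifP => _; last first.
    by rewrite mulr0 big1// => l _; rewrite mulr0 !mul0r.
  rewrite big_mkcond mulr_sumr; apply: eq_bigr => l _ /=.
  by case: ifP => _; rewrite ?mulr1 // !mulr0 mul0r.
rewrite qformE; under eq_bigr do under eq_bigr do rewrite massE.
transitivity (\sum_e \sum_k \sum_l \sum_i \sum_j t i j e k l); last first.
  apply: eq_bigr => e _; rewrite mulr_sumr; apply: eq_bigr => k _.
  rewrite mulr_sumr; apply: eq_bigr => l _.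
  rewrite !coefE mulr_suml mulr_suml mulr_sumr; apply: eq_bigr => i _.
  rewrite mulr_sumr mulr_suml mulr_sumr; apply: eq_bigr => j _.
  by rewrite /t; ring.
have out (G : 'I_N -> multi_index d p -> multi_index d p -> 'I_n -> R) :
    \sum_i \sum_e \sum_k \sum_l G e k l i = \sum_e \sum_k \sum_l \sum_i G e k l i.
  rewrite exchange_big; apply: eq_bigr => e _; rewrite exchange_big.
  by apply: eq_bigr => k _; rewrite exchange_big.
by rewrite -out; apply: eq_bigr => i _; rewrite -out.
Qed.
End assembly.

(** * The stiffness matrix *)

Lemma dotvC (R : realType) (d : nat) (u v : 'rV[R]_d) : dotv u v = dotv v u.
Proof. by rewrite /dotv !mxE; apply: eq_bigr => c _; rewrite !mxE mulrC. Qed.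

Lemma dotv_ge0 (R : realType) (d : nat) (u : 'rV[R]_d) : 0 <= dotv u u.
Proof. by rewrite /dotv mxE sumr_ge0// => c _; rewrite mxE -expr2 sqr_ge0. Qed.

Lemma dotv_sum (R : realType) (d n : nat) (v : 'I_n -> R) (g : 'I_n -> 'rV[R]_d) :
  dotv (\sum_i v i *: g i) (\sum_i v i *: g i) =
  \sum_i \sum_j v i * v j * dotv (g i) (g j).
Proof.
rewrite /dotv mulmx_suml summxE; apply: eq_bigr => i _.
rewrite (raddf_sum (@trmx R 1 d)) mulmx_sumr summxE; apply: eq_bigr => j _ /=.
by rewrite linearZ /= -scalemxAl -scalemxAr !mxE; ring.
Qed.

(** The form is the integral of [kappa] times the squared length of the gradient. *)
Lemma stiffness_psd (R : realType) (d p N n : nat) (Omega : set 'rV[R]_d)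
    (F : 'I_N -> 'rV[R]_d -> 'rV[R]_d) (xi : 'I_p.+1 -> R) (X : 'I_n -> 'rV[R]_d)
    (kappa : 'rV[R]_d -> R) :
  open Omega -> (forall y, Omega y -> 0 < kappa y) ->
  (forall i j, (lebesgue_rV R d).-integrable Omega
     (EFin \o stiffness_integrand F xi X kappa i j)) ->
  psdmx (stiffness F xi X Omega kappa).
Proof.
move=> oO kappa0 intK.
have mO : measurable (Omega : set (borel_rV R d)) by exact: sub_sigma_algebra.
apply/psdmx_qform; split=> [|v].
  apply/matrixP => i j; rewrite !mxE; apply: eq_Rintegral => y _.
  by rewrite /stiffness_integrand dotvC.
pose f i j (y : borel_rV R d) := v 0 i * v 0 j * stiffness_integrand F xi X kappa i j y.
have intf i j : (lebesgue_rV R d).-integrable Omega (EFin \o f i j).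
  rewrite (_ : EFin \o _ = fun y => ((v 0 i * v 0 j)%R%:E *
    (EFin \o stiffness_integrand F xi X kappa i j) y)%E) //.
  exact: integrableZl.
have intf1 i := Rintegral_sum (index_enum 'I_n) xpredT mO (intf i).
have intf2 := Rintegral_sum (index_enum 'I_n) xpredT mO (fun i => (intf1 i).1).
have -> : qform (stiffness F xi X Omega kappa) v =
    \int[lebesgue_rV R d]_(y in (Omega : set (borel_rV R d))) \sum_i \sum_j f i j y.
  rewrite intf2.2 qformE; apply: eq_bigr => i _; rewrite (intf1 i).2.
  by apply: eq_bigr => j _; rewrite mxE RintegralZl.
apply: Rintegral_ge0 => y /kappa0 ky.
have -> : \sum_i \sum_j f i j y = kappa y *
    dotv (\sum_i v 0 i *: gradient (glob_basis F xi X i) y)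
         (\sum_i v 0 i *: gradient (glob_basis F xi X i) y).
  rewrite dotv_sum mulr_sumr; apply: eq_bigr => i _.
  rewrite mulr_sumr; apply: eq_bigr => j _.
  by rewrite /f /stiffness_integrand; ring.
by rewrite mulr_ge0 ?dotv_ge0// ltW.
Qed.

(** * Comparison of the two mass matrices *)

Theorem lemma3p2 (R : realType) (d p N n : nat)
  (Omega : set 'rV[R]_d) (F : 'I_N -> 'rV[R]_d -> 'rV[R]_d)
  (xi w : 'I_p.+1 -> R)
  (GammaD : set 'rV[R]_d) (X : 'I_n -> 'rV[R]_d)
  (kappa rho : 'rV[R]_d -> R) (r : 'I_N -> R)
  (d_gt0 : (0 < d)%N) (p_gt0 : (0 < p)%N)
  (Omega_open : open Omega) (Omega_connected : connected Omega)
  (Omega_lipschitz : lipschitz_boundary Omega)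
  (mesh : conforming_mesh Omega F)
  (F_affine : forall e, affine_map (F e))
  (GL : gauss_lobatto xi w)
  (GammaD_boundary : GammaD `<=` closure Omega `\` Omega)
  (nodes : free_nodes F xi GammaD X)
  (kappa_gt0 : forall y, Omega y -> 0 < kappa y)
  (K_defined : forall i j, (lebesgue_rV R d).-integrable Omega
     (EFin \o stiffness_integrand F xi X kappa i j))
  (rho_measurable : measurable_fun (Omega : set (borel_rV R d)) rho)
  (rho_gt0 : forall y, Omega y -> 0 < rho y)
  (rho_const : forall e y, interior (element (F e)) y -> rho y = r e) :
  let K := stiffness F xi X Omega kappa in
  let M := consistent_mass F xi X Omega rho in
  let Mhat := lumped_mass F xi X w r in
  loewner_ge Mhat M /\
  forall k : 'I_n, gen_eigenvalue K Mhat k <= gen_eigenvalue K M k.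
Proof.
move=> K M Mhat.
pose A e := projT1 (cid (F_affine e)).
pose b e := projT1 (cid (projT2 (cid (F_affine e)))).
have FE e : F e = affine (A e) (b e).
  by apply/funext; exact: (projT2 (cid (projT2 (cid (F_affine e))))).
have [hxi _ _ _ _] := GL; have xi_inj := nodes_inj hxi.
have ME : M = assembled_mass F A xi X r (lagrange_gram xi).
  exact: (consistent_massE FE mesh Omega_open Omega_lipschitz).
have MhatE : Mhat = assembled_mass F A xi X r (diag_mx (\row_a w a)).
  exact: (lumped_massE FE mesh).
(* The image of the centre lies in Omega and in the interior of the element. *)
have r_gt0 e : 0 < r e.
  have ye : elt_interior A b e (F e 0).
    rewrite /elt_interior /= FE affineK ?(elt_unitmx FE mesh)// => c.
    by rewrite /= mxE in_itv /= ltrN10 ltr01.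
  rewrite -(rho_const e (F e 0) (elt_interior_interior FE mesh ye)).
  exact/rho_gt0/(elt_interior_Omega FE mesh Omega_open Omega_lipschitz ye).
have wt_gt0 e : 0 < r e * `|\det (A e)|.
  by rewrite mulr_gt0// normr_gt0 -unitfE -unitmxE (elt_unitmx FE mesh).
have posG := lagrange_gram_posdef xi_inj.
have symM : M^T = M by rewrite ME assembled_mass_sym// lagrange_gram_sym.
have symMhat : Mhat^T = Mhat by rewrite MhatE assembled_mass_sym// tr_diag_mx.
have M_le v : qform M v <= qform Mhat v.
  rewrite ME MhatE !qform_assembled_mass; apply: ler_sum => e _.
  rewrite ler_pM2l//; apply: tensor_form_le; first exact: posdef_psd.
  exact: lagrange_gram_le.
have posM : posdefmx M.
  split=> // v v0; rewrite ME qform_assembled_mass.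
  have [i vi] : exists i, v 0 i != 0.
    apply/existsP; apply: contraNT v0; rewrite negb_exists => /forallP h.
    by apply/eqP/rowP => i; have := h i; rewrite negbK mxE => /eqP.
  have [X_inj /seteqP[/(_ (X i))]] := nodes; case; first by exists i.
  move=> [e [k Xi]] _ _.
  (* On an element that contains the node [X i], one local coordinate is [v 0 i]. *)
  have cek : elt_coef F xi X v e k = v 0 i.
    rewrite /elt_coef (big_pred1 i)// => j.
    by rewrite -Xi (inj_eq X_inj) eq_sym.
  rewrite (bigD1 e)//= ltr_pwDl//.
    by rewrite mulr_gt0//; apply: tensor_form_gt0 => //; exists k; rewrite cek.
  apply: sumr_ge0 => e' _; rewrite mulr_ge0 ?(ltW (wt_gt0 _))//.
  by apply: tensor_form_ge0 => _; exact: posdef_psd.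
have posMhat : posdefmx Mhat.
  by split=> // v v0; rewrite (lt_le_trans _ (M_le v))//; have [_] := posM; apply.
split.
  apply/psdmx_qform; split; first by rewrite linearB /= symMhat symM.
  by move=> v; rewrite qformB subr_ge0.
have /psdmx_qform[symK K0] : psdmx K by exact: stiffness_psd.
by move=> k; exact: gen_eigenvalue_anti.
Qed.
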